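(* Let $P(a)\subset\mathbb R^d$ be an irreducible Voronoi parallelotope, $P(a)=\{x\in\mathbb R^d:\langle p,x\rangle\le a(p)\ \text{for all } p\in\mathcal P\}$, where $\mathcal P\supseteq\mathcal P(a)\supseteq\mathcal P_s(a)$. Let $e\in\mathbb R^d$ be a vector. Then one can choose a length of the vector $e$ such that the following assertions are equivalent: (i) the Minkowski sum $P(a)+bz(e)$ is a Voronoi parallelotope for any $b\ge 0$, and $$P(a)+bz(e)=P(a)+P(a_e)=P(a+a_e),\qquad\text{where } a_e(p)=b\langle p,e\rangle^2;$$ (ii) $e\in\mathcal P_s^*(a)$.
   Context: Let $\mathcal P\subset\mathbb R^d$ be a symmetric set of vectors ($p\in\mathcal P\Rightarrow -p\in\mathcal P$). For a function $a:\mathcal P\to\mathbb R$ put $P(a)=\{x\in\mathbb R^d:\langle p,x\rangle\le a(p)\ \text{for all } p\in\mathcal P\}$. The polytopes $P(a)$, $P(a_e)$, $P(a+a_e)$ are all defined in this way with the same set $\mathcal P$. A $d$-dimensional polytope of the form $P(a)$ is called a Voronoi parallelotope if: (1) $a(p)=\langle p,Ap\rangle$ is a non-negative quadratic form; (2) $\mathcal P$ contains the set $\mathcal P_s(a)\subset L$ of normal vectors of all facets of $P(a)$, the normal vector $p$ of a facet being taken so that the facet is $P(a)\cap\{x:\langle p,x\rangle=a(p)\}$; (3) $\mathcal P_s(a)$ generates integrally a $d$-dimensional lattice $L$. $\mathcal P(a)\subset L$ is the set of minimal (with respect to the form $a$) vectors of each parity class of $L$, a parity class being a coset of $2L$ in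 $L$; its elements are called contact vectors. The dual of $\mathcal P_s(a)$ is $\mathcal P_s^*(a)=\{e\in\mathbb R^d:\langle e,p\rangle\in\{0,\pm1\}\ \text{for all } p\in\mathcal P_s(a)\}$. $z(e)=\{\lambda e:-1\le\lambda\le1\}$ is a segment, and $bz(e)$ is its dilation by $b$. A parallelotope is a polytope whose parallel translations fill its space without gaps and without intersections by inner points. A parallelotope $P$ is reducible if $P=P_1\oplus P_2$, where $\oplus$ denotes direct sum, and irreducible otherwise.
   Formalization: The length of e is one at which (i), resp. (ii), holds whenever it holds at some positive length; for (ii) this is asserted only if the set 𝒫 lies in the lattice L, since an extra redundant vector of 𝒫 outside L can make (i) fail at every length while (ii) holds. *)

(* Defs.v *)
(* MathComp / MathComp-Analysis *)
From HB Require Import structures.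
From mathcomp Require Import all_boot all_order all_algebra.
From mathcomp Require Import boolp classical_sets reals.

Set Implicit Arguments.
Unset Strict Implicit.
Unset Printing Implicit Defensive.

Import Order.TTheory GRing.Theory Num.Theory.
Local Open Scope classical_set_scope.
Local Open Scope ring_scope.

Section Polytopes.
Variables (R : realType) (d : nat).
Implicit Types (u v p q x e : 'rV[R]_d) (A B Q : set 'rV[R]_d).

Definition dotp u v : R := \sum_(i < d) u 0 i * v 0 i.

Definition minkowski A B : set 'rV[R]_d := [set x + y | x in A & y in B].

Definition symmetric_set A : Prop := forall p, A p -> A (- p).

(* The affine hull of A has dimension k: it is x0 plus the row space of M. *)
Definition affine_dim A (k : nat) : Prop :=
  exists (x0 : 'rV[R]_d) (M : 'M[R]_(k, d)),
    [/\ row_free M, A x0, (forall i, A (x0 + row i M))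
      & forall x, A x -> (x - x0 <= M)%MS].

Definition convex_hull n (v : 'I_n -> 'rV[R]_d) : set 'rV[R]_d :=
  [set x | exists w : 'I_n -> R,
    [/\ forall i, 0 <= w i, \sum_i w i = 1 & x = \sum_i w i *: v i]].

Definition is_polytope Q : Prop :=
  exists n (v : 'I_n -> 'rV[R]_d), Q = convex_hull v.

(* Q = Q1 (+) Q2, where Q1 and Q2 lie in complementary nonzero subspaces,
   given as the row spaces of U and V. *)
Definition reducible Q : Prop :=
  exists (U V : 'M[R]_d) (Q1 Q2 : set 'rV[R]_d),
    [/\ U != 0, V != 0, (U :&: V)%MS = 0 & row_full (U + V)%MS] /\
    [/\ forall x, Q1 x -> (x <= U)%MS, forall x, Q2 x -> (x <= V)%MS
      & Q = minkowski Q1 Q2].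

Definition irreducible Q : Prop := ~ reducible Q.

Definition integral_span A : set 'rV[R]_d :=
  [set x | exists n (c : 'I_n -> int) (v : 'I_n -> 'rV[R]_d),
    (forall i, A (v i)) /\ x = \sum_i v i *~ c i].

(* d-dimensional lattice of R^d: the integral combinations of the rows of an
   invertible matrix. *)
Definition full_lattice A : Prop :=
  exists2 B : 'M[R]_d, B \in unitmx
    & A = [set map_mx intr z *m B | z in [set: 'rV[int]_d]].

Definition nneg_quadratic_form (a : 'rV[R]_d -> R) : Prop :=
  exists A : 'M[R]_d,
    [/\ A^T = A, (forall p, a p = dotp p (p *m A)) & forall p, 0 <= a p].

Definition segment e : set 'rV[R]_d :=
  [set l *: e | l in [set l : R | -1 <= l <= 1]].

Definition dilate (b : R) A : set 'rV[R]_d := [set b *: x | x in A].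

Definition dual A : set 'rV[R]_d :=
  [set e | forall p, A p -> [\/ dotp e p = 0, dotp e p = 1 | dotp e p = -1]].

Section WithNormals.
Variable cP : set 'rV[R]_d.

Definition PP (a : 'rV[R]_d -> R) : set 'rV[R]_d :=
  [set x | forall p, cP p -> dotp p x <= a p].

(* Only used when PP a has dimension d.  The equation <p, x> = a(p) fixes the
   length of the normal vector p, a being quadratic. *)
Definition facet_normals (a : 'rV[R]_d -> R) : set 'rV[R]_d :=
  [set p | [/\ p != 0, (forall x, PP a x -> dotp p x <= a p)
             & affine_dim (PP a `&` [set x | dotp p x = a p]) d.-1]].

Definition lattice (a : 'rV[R]_d -> R) : set 'rV[R]_d :=
  integral_span (facet_normals a).

Definition voronoi_form (a : 'rV[R]_d -> R) : Prop :=
  (is_polytope (PP a) /\ affine_dim (PP a) d) /\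
  [/\ nneg_quadratic_form a, facet_normals a `<=` cP
    & full_lattice (lattice a)].

Definition voronoi_parallelotope Q : Prop :=
  exists2 a, voronoi_form a & Q = PP a.

(* All parity classes are considered, including 2L itself. *)
Definition contact_vectors (a : 'rV[R]_d -> R) : set 'rV[R]_d :=
  [set p | lattice a p /\
     forall u, lattice a u -> a p <= a (p + u *+ 2)].

Definition rank1_form (b : R) e : 'rV[R]_d -> R :=
  fun p => b * dotp p e ^+ 2.

Definition segment_sum_voronoi (a : 'rV[R]_d -> R) e : Prop :=
  forall b : R, 0 <= b ->
    let S := minkowski (PP a) (dilate b (segment e)) in
    [/\ voronoi_parallelotope S,
        S = minkowski (PP a) (PP (rank1_form b e))
      & S = PP (fun p => a p + rank1_form b e p)].

End WithNormals.
End Polytopes.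

(* Main.v *)
Require Import Defs.
From mathcomp Require Import all_boot all_order all_algebra.
From mathcomp Require Import boolp classical_sets reals.
From mathcomp Require Import ring lra zify.

Set Implicit Arguments.
Unset Strict Implicit.
Unset Printing Implicit Defensive.

Import Order.TTheory GRing.Theory Num.Theory.
Local Open Scope classical_set_scope.
Local Open Scope ring_scope.

(** The parallelotope is P = {x : <q, x> <= a(q), q in cP}, and the sum with
    b z(e) should be cut out by the form a_b(q) = a(q) + b <q, e>^2.

    From the sum to the dual set.  The support function of P + b z(e) at q is at
    most a(q) + b |<q, e>|, with equality on facet normals.  Since b is arbitrary,
    |<q, e>| <= <q, e>^2 for every q in cP ([sum_within_norm]).  If <p, e> > 1 at
    a facet normal p, the facet of the sum with normal p could be pushed outwards
    without violating any constraint of a_b ([facet_dotp_le1]).  As cP may be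
    infinite, this needs a bound which is uniform in q: a constraint of P nearly
    tight inside the facet is close to that of p, and then <q, e>^2 - <q, e> stays
    away from 0 ([slack_growth]).

    From the dual set to the sum, when cP lies in the lattice L generated by the
    facet normals.  The form a is positive definite ([form_unitmx]): contact
    vectors are short in their parity classes, which bounds the products with a
    lattice vector u by a(u), and Dirichlet approximation near a kernel vector
    would give a nonzero isotropic contact vector.  So L is locally finite, minima
    over parity classes exist, and one may argue by induction on a.

    The heart is [contact_dotp_le1]: if e is dual to the facet normals, every
    parity class has a minimal vector u with |<u, e>| <= 1.  If plus and minus u
    are the only minimal vectors of their class, then u is a facet normal, by
    Voronoi.  Otherwise u is an orthogonal sum of two shorter contact vectors;
    each can be replaced inside its class by one with |<., e>| <= 1, and either
    the sum or the difference of the replacements does the same for u.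

    Such representatives stay minimal for a_b, so their constraints imply all
    others ([constraint_descent], by the parallelogram law).  A point z is then in
    P + b z(e) as soon as the lower bounds on the shift along e, coming from
    <v, e> = 1, do not exceed the upper bounds, coming from <w, e> = -1; this is
    the parallelogram law once more, for the parity class of v - w
    ([shift_compatible]).  Finally the facet normals for a_b lie in cP and include
    those for a, so they generate the same lattice ([sum_voronoi_form]).

    The length of e: if some positive multiple of e satisfies the first
    assertion, it satisfies both.  If none does, a multiple outside the dual set
    satisfies neither; it exists unless e = 0, where the first assertion holds. *)

(** * The inner product and positive semidefinite forms *)

Section InnerProduct.
Variables (R : realType) (d : nat).
Implicit Types (u v w : 'rV[R]_d) (A : 'M[R]_d).

Lemma dotpE u v : dotp u v = (u *m v^T) 0 0.
Proof. by rewrite mxE; apply: eq_bigr => i _; rewrite mxE. Qed.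

Lemma dotpC u v : dotp u v = dotp v u.
Proof. by apply: eq_bigr => i _; rewrite mulrC. Qed.

Lemma dotpDl u v w : dotp (u + v) w = dotp u w + dotp v w.
Proof. by rewrite !dotpE mulmxDl mxE. Qed.

Lemma dotpZl c u v : dotp (c *: u) v = c * dotp u v.
Proof. by rewrite !dotpE -scalemxAl mxE. Qed.

Lemma dotpDr u v w : dotp u (v + w) = dotp u v + dotp u w.
Proof. by rewrite !(dotpC u) dotpDl. Qed.

Lemma dotpZr c u v : dotp u (c *: v) = c * dotp u v.
Proof. by rewrite !(dotpC u) dotpZl. Qed.

Lemma dotpNl u v : dotp (- u) v = - dotp u v.
Proof. by rewrite -scaleN1r dotpZl mulN1r. Qed.

Lemma dotpNr u v : dotp u (- v) = - dotp u v.
Proof. by rewrite !(dotpC u) dotpNl. Qed.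

Lemma dotp0l u : dotp 0 u = 0.
Proof. by rewrite -(scale0r 0) dotpZl mul0r. Qed.

Lemma dotp0r u : dotp u 0 = 0.
Proof. by rewrite dotpC dotp0l. Qed.

Lemma dotpMnl u v n : dotp (u *+ n) v = dotp u v *+ n.
Proof. by rewrite -scaler_nat dotpZl mulr_natl. Qed.

Lemma dotp_suml n (f : 'I_n -> 'rV[R]_d) v :
  dotp (\sum_i f i) v = \sum_i dotp (f i) v.
Proof. by rewrite dotpE mulmx_suml summxE; apply: eq_bigr => i _; rewrite dotpE. Qed.

Definition dotpl := (dotpDl, dotpNl, dotpZl).
Definition dotpr := (dotpDr, dotpNr, dotpZr).

Lemma dotpp_eq0 u : dotp u u = 0 -> u = 0.
Proof.
move=> uu0; apply/rowP => i; rewrite mxE.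
have sq_ge0 (j : 'I_d) : true -> 0 <= u 0 j * u 0 j by rewrite -expr2 sqr_ge0.
have /eqP := uu0; rewrite psumr_eq0 // => /allP /(_ i (mem_index_enum i)).
by rewrite mulf_eq0 orbb => /eqP.
Qed.

Lemma dotpp_gt0 u : u != 0 -> 0 < dotp u u.
Proof.
move=> u0; rewrite lt_def; apply/andP; split.
  by apply: contraNneq u0 => /dotpp_eq0 ->.
by apply: sumr_ge0 => i _; rewrite -expr2 sqr_ge0.
Qed.

Lemma dotp_mulmxC A u v : A^T = A -> dotp u (v *m A) = dotp v (u *m A).
Proof.
by move=> AT; rewrite dotpC !dotpE trmx_mul AT mulmxA.
Qed.

Lemma quad_parallelogram A u v :
  dotp (u + v) ((u + v) *m A) + dotp (u - v) ((u - v) *m A) =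
  2 * (dotp u (u *m A) + dotp v (v *m A)).
Proof. by rewrite !mulmxDl !mulNmx !(dotpl, dotpr); ring. Qed.

Lemma psd_cauchy_schwarz A u v : A^T = A ->
    (forall w, 0 <= dotp w (w *m A)) ->
  dotp u (v *m A) ^+ 2 <= dotp u (u *m A) * dotp v (v *m A).
Proof.
move=> AT A0.
set auu := dotp u (u *m A); set avv := dotp v (v *m A).
set auv := dotp u (v *m A).
have H t : 0 <= auu + 2 * t * auv + t ^+ 2 * avv.
  have := A0 (u + t *: v); rewrite mulmxDl -scalemxAl !(dotpl, dotpr).
  by rewrite (dotp_mulmxC v u AT) -/auu -/avv -/auv; nra.
have avv0 : 0 <= avv by exact: A0.
have [avvE|avvn] := eqVneq avv 0.
  have [->|auvn] := eqVneq auv 0; first by rewrite avvE mulr0 expr0n.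
  have := H (- (auu + 1) / (2 * auv)).
  rewrite avvE mulr0 addr0.
  have -> : 2 * (- (auu + 1) / (2 * auv)) * auv = - (auu + 1) by field.
  by lra.
have avvp : 0 < avv by rewrite lt_def avvn.
have := H (- auv / avv).
have -> : auu + 2 * (- auv / avv) * auv + (- auv / avv) ^+ 2 * avv
   = (auu * avv - auv ^+ 2) / avv by field.
by rewrite pmulr_lge0 ?invr_gt0 // subr_ge0.
Qed.

Lemma psd_kernel A u : A^T = A -> (forall w, 0 <= dotp w (w *m A)) ->
  dotp u (u *m A) = 0 -> u *m A = 0.
Proof.
move=> AT A0 u0; apply: dotpp_eq0.
have := psd_cauchy_schwarz (u *m A) u AT A0.
by rewrite u0 mulr0 => H; apply/eqP; rewrite -sqrf_eq0 eq_le H sqr_ge0.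
Qed.

End InnerProduct.

(** * Facets of intersections of half-spaces *)

Section Facets.
Variables (R : realType) (d : nat).
Implicit Types (u x y p q : 'rV[R]_d) (cP : set 'rV[R]_d) (g : 'rV[R]_d -> R).

Lemma dotp_mulmx k q (w : 'rV[R]_k) (M : 'M[R]_(k, d)) :
  dotp q (w *m M) = \sum_i w 0 i * dotp q (row i M).
Proof.
rewrite mulmx_sum_row dotpC dotp_suml; apply: eq_bigr => i _.
by rewrite dotpZl dotpC.
Qed.

Lemma sub_kermx_dotp u x : (x <= kermx u^T)%MS = (dotp u x == 0).
Proof.
rewrite dotpC dotpE; apply/sub_kermxP/eqP => [->|xu]; first by rewrite mxE.
by apply/matrixP => i j; rewrite !ord1 xu mxE.
Qed.

Lemma rank_kermx_dotp u : u != 0 -> \rank (kermx u^T) = d.-1.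
Proof. by move=> u0; rewrite mxrank_ker mxrank_tr rank_rV u0 subn1. Qed.

Lemma hyperplane_basis u : u != 0 ->
  exists2 M : 'M[R]_(d.-1, d), row_free M & forall i, dotp u (row i M) = 0.
Proof.
move=> u0; have K := row_base_free (kermx u^T).
have E := eq_row_base (kermx u^T).
move: K E; move: (row_base _); rewrite rank_kermx_dotp // => M Mfree ME.
exists M => // i; apply/eqP; rewrite -sub_kermx_dotp -ME row_sub //.
Qed.

Lemma hyperplane_sub u (M : 'M[R]_(d.-1, d)) x : u != 0 -> row_free M ->
  (forall i, dotp u (row i M) = 0) -> dotp u x = 0 -> (x <= M)%MS.
Proof.
move=> u0 Mfree Mu ux.
have MK : (M <= kermx u^T)%MS.
  by apply/row_subP => i; rewrite sub_kermx_dotp Mu.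
have [_ rkE] := mxrank_leqif_sup MK.
move: rkE; rewrite rank_kermx_dotp // (eqP Mfree) eqxx => /esym KM.
by apply: submx_trans KM; rewrite sub_kermx_dotp ux.
Qed.

Lemma PP_convex cP g x y t : 0 <= t <= 1 -> PP cP g x -> PP cP g y ->
  PP cP g (t *: x + (1 - t) *: y).
Proof.
move=> t01 Px Py p cPp; rewrite !dotpr.
by have := Px p cPp; have := Py p cPp; nra.
Qed.

Lemma PP_opp cP g x : symmetric_set cP -> (forall p, g (- p) = g p) ->
  PP cP g x -> PP cP g (- x).
Proof.
by move=> cPN gN Px p cPp; rewrite dotpNr -dotpNl -gN; apply/Px/cPN.
Qed.

(** The witness is the barycentre of the frame: all its barycentric coordinates
    are positive, so they stay nonnegative under a small change. *)
Lemma relative_interior cP g k x0 (M : 'M[R]_(k, d)) :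
    PP cP g x0 -> (forall i, PP cP g (x0 + row i M)) ->
  exists2 y, (y - x0 <= M)%MS
    & forall x, (x <= M)%MS -> exists2 h, 0 < h & PP cP g (y + h *: x).
Proof.
move=> P0 PM; pose c : R := k.+1%:R^-1.
have c0 : 0 < c by rewrite invr_gt0 ltr0Sn.
have kc : k%:R * c + c = 1.
  by rewrite -[X in _ + X]mul1r -mulrDl addrC -mulrS mulfV // pnatr_eq0.
exists (x0 + const_mx c *m M); first by rewrite addrC addKr submxMl.
move=> _ /submxP [D ->].
pose s := \sum_i `|D 0 i|; have s0 : 0 <= s by apply: sumr_ge0.
pose h := c / (1 + s); have h0 : 0 < h by rewrite divr_gt0 // ltr_wpDr.
have hs : h * s <= c.
  rewrite /h mulrAC ler_pdivrMr ?ltr_wpDr // ler_pM2l //; lra.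
exists h => //; rewrite -addrA scalemxAl -mulmxDl => q cPq.
rewrite dotpDr dotp_mulmx.
have slack0 : 0 <= g q - dotp q x0 by rewrite subr_ge0 P0.
set w := const_mx c + h *: D.
have hD i : h * `|D 0 i| <= c.
  apply: le_trans hs; rewrite ler_pM2l // /s (bigD1 i) //= lerDl.
  exact: sumr_ge0.
have w0 i : 0 <= w 0 i.
  have := hD i; rewrite !mxE; have := ler_norm (- D 0 i); rewrite normrN.
  by nra.
have w1 : \sum_i w 0 i <= 1.
  under eq_bigr do rewrite !mxE.
  rewrite big_split /= sumr_const card_ord -mulr_natl -mulr_sumr.
  apply: (@le_trans _ _ (k%:R * c + c)); last by rewrite kc.
  rewrite lerD2l; apply: le_trans hs; rewrite ler_pM2l //; apply: ler_sum => i _.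
  exact: ler_norm.
suff : \sum_i w 0 i * dotp q (row i M) <= g q - dotp q x0 by lra.
apply: (@le_trans _ _ ((\sum_i w 0 i) * (g q - dotp q x0))).
  rewrite mulr_suml; apply: ler_sum => i _; apply: ler_wpM2l => //.
  by have := PM i q cPq; rewrite dotpDr; lra.
by nra.
Qed.

Lemma facet_relative_interior cP g p : facet_normals cP g p ->
  exists y, [/\ PP cP g y, dotp p y = g p
    & forall x, dotp p x = 0 -> exists2 h, 0 < h & PP cP g (y + h *: x)].
Proof.
case=> p0 _ [x0 [M [Mfree [P0 p_x0] PM _]]].
have Mp i : dotp p (row i M) = 0.
  by have [_] := PM i; rewrite /= dotpDr p_x0; lra.
have [y yM yP] := relative_interior P0 (fun i => (PM i).1).
exists y; split.
- by have [h _] := yP 0 (sub0mx _ _); rewrite scaler0 addr0.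
- have /submxP [D yE] := yM.
  rewrite -(subrK x0 y) yE dotpDr dotp_mulmx p_x0 big1 ?add0r // => i _.
  by rewrite Mp mulr0.
- by move=> x px; apply: yP; apply: hyperplane_sub Mfree Mp px.
Qed.

Lemma full_dim_interior cP g : affine_dim (PP cP g) d ->
  exists y, forall x, exists2 h, 0 < h & PP cP g (y + h *: x).
Proof.
case=> x0 [M [Mfree P0 PM _]].
have [y _ yP] := relative_interior P0 PM.
exists y => x; apply: yP; apply: submx_full.
by rewrite row_full_unit -row_free_unit.
Qed.

(** The origin is the midpoint of an interior point and its opposite. *)
Lemma symmetric_interior cP g : affine_dim (PP cP g) d ->
    symmetric_set cP -> (forall p, g (- p) = g p) ->
  forall x, exists2 h, 0 < h & PP cP g (h *: x).
Proof.
move=> Pd cPN gN x; have [y yP] := full_dim_interior Pd.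
have [h h0 Ph] := yP x.
have Py : PP cP g y by have [k _] := yP 0; rewrite scaler0 addr0.
exists (2^-1 * h); first by rewrite mulr_gt0 ?invr_gt0.
have -> : (2^-1 * h) *: x = 2^-1 *: (y + h *: x) + (1 - 2^-1) *: (- y).
  apply/rowP => i; rewrite !mxE; lra.
by apply: PP_convex => //; [lra | apply: PP_opp].
Qed.

Lemma symmetric_support_gt0 cP g p c : affine_dim (PP cP g) d ->
    symmetric_set cP -> (forall q, g (- q) = g q) ->
  p != 0 -> (forall x, PP cP g x -> dotp p x <= c) -> 0 < c.
Proof.
move=> Pd cPN gN p0 pc; have [h h0 Ph] := symmetric_interior Pd cPN gN p.
apply: lt_le_trans (pc _ Ph); rewrite dotpZr mulr_gt0 //.
exact: dotpp_gt0.
Qed.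

Lemma facet_normalsI cP g p x0 (M : 'M[R]_(d.-1, d)) :
    p != 0 -> (forall x, PP cP g x -> dotp p x <= g p) ->
    row_free M -> (forall i, dotp p (row i M) = 0) ->
    dotp p x0 = g p -> PP cP g x0 -> (forall i, PP cP g (x0 + row i M)) ->
  facet_normals cP g p.
Proof.
move=> p0 pv Mfree Mp p_x0 P0 PM; split=> //.
exists x0, M; split=> //.
- by move=> i; split; [exact: PM | rewrite /= dotpDr Mp addr0].
- move=> x [_ /= px]; apply: (hyperplane_sub p0) => //.
  by rewrite dotpDr dotpNr px p_x0 subrr.
Qed.

End Facets.

(** * A sum with a segment forces the length of the segment *)

Section RealEstimate.
Variable R : realType.

(** The real-number content of [facet_dotp_le1].  There a constraint [q] is
    written [t *: p + q'] with [q'] orthogonal to a facet normal [p]; [al] is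
    [a p], [s] is [<p, e>], [r] is the slack of [q] at a point inside the facet,
    and [e2], [u2], [u3], [c] are the contributions of [q'] to [<q, e>] and to
    the equation that expresses [r].  All of these being bounded by [r], a
    small [r] forces [t] to be close to [1]; then [<q, e>] is close to [s > 1]
    and the second summand of the conclusion is bounded below. *)
Lemma slack_growth (al K1 K2 K3 C s : R) :
    0 < al -> 0 <= K1 -> 0 <= K2 -> 0 <= K3 -> 0 <= C -> 1 < s ->
  exists2 h : R, 0 < h & forall t r e2 u2 u3 c : R,
    0 <= r -> `|e2| <= K1 * r -> `|u2| <= K2 * r -> `|u3| <= K3 * r ->
    0 <= c <= C * r ^+ 2 ->
    r = (t ^+ 2 - t) * al + 2 * t * u2 + c - u3 ->
    0 <= (t * s + e2) ^+ 2 - (t * s + e2) ->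
    h * t <= r + ((t * s + e2) ^+ 2 - (t * s + e2)).
Proof.
move=> al0 K10 K20 K30 C0 s1.
have s0 : 0 <= s by lra.
have al0' := ltW al0.
pose D := 1 + 4 * K2 + K3 + C; have D1 : 1 <= D by rewrite /D; lra.
have D0 : 0 < D by exact: lt_le_trans D1.
have DE : D = 1 + 4 * K2 + K3 + C by [].
(* With [t] within [dl] of [1], [t * s] exceeds [1] by at least [3/4] of
   [s - 1]. *)
pose dl := (s - 1) / (4 * s).
have dls : dl * (4 * s) = s - 1 by rewrite /dl; field; lra.
have dl0 : 0 < dl by rewrite divr_gt0; lra.
have dl4 : dl < 4^-1 by nra.
pose h3 := al * dl / D; have h30 : 0 < h3 by apply: divr_gt0 => //; exact: mulr_gt0.
have h3E : h3 * D = al * dl by rewrite /h3 divfK // gt_eqF.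
pose h5 := (s - 1) / (8 * (K1 + 1)).
have h50 : 0 < h5 by rewrite divr_gt0 //; lra.
have h5E : h5 * (8 * (K1 + 1)) = s - 1 by rewrite /h5; field; lra.
exists (Num.min (Num.min 2^-1 h3) (Num.min ((s - 1) / 4) h5)).
  rewrite !lt_min h30 h50 invr_gt0 ltr0n /= divr_gt0 //; lra.
set h := Num.min _ _.
have [hh2 hh3 hh4 hh5] : [/\ h <= 2^-1, h <= h3, h <= (s - 1) / 4 & h <= h5].
  by split; rewrite /h !ge_min lexx ?orbT.
have h0 : 0 < h.
  rewrite !lt_min h30 h50 invr_gt0 ltr0n /= divr_gt0 //; lra.
clearbody h h3 h5 D dl => t r e2 u2 u3 c r0.
rewrite !ler_norml => /andP [e2l e2u] /andP [u2l u2u] /andP [u3l u3u].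
move=> /andP [c0 cu] rE q0.
have ht r' : h <= r' -> 0 <= t -> h * t <= r' * t.
  by move=> hr t0; apply: ler_wpM2r.
have [t0|t0] := lerP t 0.
  have : h * t <= 0 by rewrite pmulr_rle0.
  by lra.
suff : h * t <= r \/ h * t <= (t * s + e2) ^+ 2 - (t * s + e2) by case; lra.
have t0' := ltW t0.
have tu2l : 0 <= t * (u2 + K2 * r) by apply: mulr_ge0 => //; lra.
have tu2u : 0 <= t * (K2 * r - u2) by apply: mulr_ge0 => //; lra.
have up : (t - 1) * t * al <= r * (1 + 2 * t * K2 + K3) by lra.
have lo : (1 - t) * t * al <= r * (2 * t * K2 + K3) + c by lra.
clear tu2l tu2u rE e2u u2u u3l u3u u2l q0.
have tal : 0 < t * al by exact: mulr_gt0.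
(* [far] covers the values of [t] at distance at least [dl] from [1]. *)
have far : dl * (t * al) <= D * r -> h * t <= r.
  move=> H; apply: (le_trans (ht _ hh3 t0')).
  rewrite -(ler_pM2l D0); have -> : D * (h3 * t) = h3 * D * t by ring.
  by rewrite h3E; lra.
clear h3E.
have Dr0 : 0 <= D * r by apply: mulr_ge0 => //; exact: ltW.
have /orP [t2|t2] := le_total 2 t.
  left; apply: far.
  have B : (t - 1) * t * al <= r * (D * t).
    apply: le_trans up _; apply: ler_wpM2l => //; rewrite DE.
    have : 0 <= K3 * (t - 1) by rewrite mulr_ge0 ?subr_ge0 // (le_trans _ t2) // ler1n.
    have : 0 <= K2 * t by exact: mulr_ge0.
    have : 0 <= C * t by exact: mulr_ge0.
    by lra.
  have : (t - 1) * al <= r * D.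
    by rewrite -(ler_pM2r t0); move: B; rewrite mulrA mulrAC.
  have : 0 <= (t - 2) * al by rewrite mulr_ge0 ?subr_ge0.
  have : dl * (t * al) <= 4^-1 * (t * al).
    by apply: ler_wpM2r; exact: ltW.
  by lra.
have /orP [r1|r1] := le_total 1 r.
  by left; have := ht _ hh2 t0'; lra.
have cr : c <= C * r.
  have : 0 <= C * r * (1 - r) by apply: mulr_ge0; [exact: mulr_ge0 | rewrite subr_ge0].
  by lra.
have K2t : 0 <= K2 * (2 - t) by rewrite mulr_ge0 ?subr_ge0.
have up2 : (t - 1) * t * al <= D * r.
  apply: le_trans up _; rewrite mulrC; apply: ler_wpM2r => //.
  by rewrite DE; lra.
have lo2 : (1 - t) * t * al <= D * r.
  have : (1 - t) * t * al <= r * (2 * t * K2 + K3 + C) by lra.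
  move=> /le_trans; apply; rewrite mulrC; apply: ler_wpM2r => //.
  by rewrite DE; lra.
have near w : dl <= w -> w * t * al <= D * r -> h * t <= r.
  move=> dw wD; apply: far; apply: le_trans wD; rewrite -mulrA.
  by apply: ler_wpM2r => //; exact: ltW.
have /orP [tl|tl] := le_total dl (t - 1); first by left; exact: near up2.
have /orP [tl'|tl'] := le_total dl (1 - t); first by left; exact: near lo2.
have ts : s - (s - 1) / 4 <= t * s.
  have : 0 <= (dl - (1 - t)) * s by rewrite mulr_ge0 ?subr_ge0.
  by lra.
have h2t : h * t <= h * 2 by apply: ler_wpM2l => //; exact: ltW.
have /orP [Kr|Kr] := le_total (K1 * r) ((s - 1) / 4).
  right; set x := t * s + e2.
  have x1 : (s + 1) / 2 <= x by rewrite /x; lra.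
  have := sqr_ge0 (x - 1).
  by lra.
left; have : h5 * 2 <= r.
  have K1p : 0 < 4 * (K1 + 1) by lra.
  have : 4 * (K1 + 1) * (h5 * 2) <= 4 * (K1 + 1) * r by lra.
  by rewrite ler_pM2l.
by lra.
Qed.

End RealEstimate.

Section SegmentLength.
Variables (R : realType) (d : nat).
Implicit Types (e p q u w x y z : 'rV[R]_d) (cP : set 'rV[R]_d).
Implicit Types (a : 'rV[R]_d -> R).

Lemma sum_segmentP cP a e b z : 0 <= b ->
  minkowski (PP cP a) (dilate b (segment e)) z <->
  exists2 l : R, - b <= l <= b & PP cP a (z - l *: e).
Proof.
move=> b0; split.
  case=> x Px [_ [_ [l /= l1 <-] <-] <-]; exists (b * l); first by nra.
  by rewrite scalerA addrK.
case=> l lb Pz; exists (z - l *: e) => //; exists (l *: e); last by rewrite subrK.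
have [b0'|bn0] := eqVneq b 0.
  have -> : l = 0 by lra.
  by exists 0; rewrite ?b0' ?scaler0 ?scale0r //; exists 0; rewrite ?scale0r //=; lra.
have bp : 0 < b by rewrite lt_def bn0.
exists ((l / b) *: e); last by rewrite scalerA mulrCA mulfV // mulr1.
by exists (l / b) => //=; rewrite ler_pdivlMr // ler_pdivrMr //; lra.
Qed.

Lemma rank1_formN b e p : rank1_form b (- e) p = rank1_form b e p.
Proof. by rewrite /rank1_form dotpNr sqrrN. Qed.

Lemma quadN (A : 'M[R]_d) p : dotp (- p) (- p *m A) = dotp p (p *m A).
Proof. by rewrite mulNmx !(dotpl, dotpr) opprK. Qed.

(** Moving inside the facet by [h *: x] or [- h *: x] changes [<q, y>] by at most
    the slack of [q]; for [x] one takes the projection of [w] to the facet. *)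
Lemma facet_slack_bound cP a p y w : p != 0 ->
    (forall x, dotp p x = 0 -> exists2 h, 0 < h & PP cP a (y + h *: x)) ->
  exists2 K : R, 0 <= K & forall q, cP q ->
    `|dotp (q - (dotp q p / dotp p p) *: p) w| <= K * (a q - dotp q y).
Proof.
move=> p0 yP; have pp0 := dotpp_gt0 p0.
pose x := w - (dotp p w / dotp p p) *: p.
have px : dotp p x = 0 by rewrite !(dotpl, dotpr) mulfVK ?subrr ?gt_eqF.
have qx q : dotp (q - (dotp q p / dotp p p) *: p) w = dotp q x.
  rewrite !(dotpl, dotpr) (dotpC p w) (dotpC q p); field; exact: lt0r_neq0.
clearbody x.
have [h1 h10 P1] := yP x px.
have [h2 h20 P2] := yP (- x) (etrans (dotpNr p x) (etrans (f_equal _ px) (oppr0 _))).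
exists (h1^-1 + h2^-1) => [|q cPq].
  by rewrite addr_ge0 // invr_ge0 ltW.
rewrite qx.
have Q1 := P1 q cPq; have Q2 := P2 q cPq; move: Q1 Q2; rewrite !dotpr.
set v := dotp q x => Q1 Q2.
set s := a q - dotp q y.
have s1 : v <= h1^-1 * s by rewrite ler_pdivlMl // /s; lra.
have s2 : - v <= h2^-1 * s by rewrite ler_pdivlMl // /s; lra.
have r0 : 0 <= s.
  have /orP [v0|v0] := le_total 0 v.
    by have := mulr_ge0 (ltW h10) v0; rewrite /s; lra.
  by have := mulr_ge0 (ltW h20) (etrans (oppr_ge0 v) v0); rewrite /s; lra.
have i1 : 0 < h1^-1 by rewrite invr_gt0.
have i2 : 0 < h2^-1 by rewrite invr_gt0.
have := mulr_ge0 (ltW i1) r0; have := mulr_ge0 (ltW i2) r0.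
by rewrite ler_norml; lra.
Qed.

End SegmentLength.
Section SegmentDual.
Variables (R : realType) (d : nat) (cP : set 'rV[R]_d) (A : 'M[R]_d).
Variable a : 'rV[R]_d -> R.
Implicit Types (e p q u w x y z : 'rV[R]_d).
Hypotheses (cPN : symmetric_set cP) (AT : A^T = A).
Hypotheses (aE : forall p, a p = dotp p (p *m A)) (a0 : forall p, 0 <= a p).
Hypothesis FcP : facet_normals cP a `<=` cP.
Hypothesis Pd : affine_dim (PP cP a) d.

Lemma quad_formN p : a (- p) = a p.
Proof. by rewrite !aE quadN. Qed.

Lemma PP_origin : PP cP a 0.
Proof. by move=> q _; rewrite dotp0r. Qed.

Definition sum_within e := forall b : R, 0 <= b -> forall z,
  minkowski (PP cP a) (dilate b (segment e)) z ->
  PP cP (fun p => a p + rank1_form b e p) z.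

Definition sum_covers e := forall b : R, 0 <= b -> forall z,
  PP cP (fun p => a p + rank1_form b e p) z ->
  minkowski (PP cP a) (dilate b (segment e)) z.

(** The support function of the sum grows like [b * |<q, e>|] whereas the
    right-hand side of the constraint grows like [b * <q, e> ^ 2]. *)
Lemma sum_within_norm e q : sum_within e -> cP q ->
  `|dotp q e| <= dotp q e ^+ 2.
Proof.
move=> He cPq; rewrite leNgt; apply/negP => lt1.
pose c := `|dotp q e| - dotp q e ^+ 2; have c0 : 0 < c by rewrite subr_gt0.
have aq0 := a0 q.
pose b := (a q + 1) / c; have b0 : 0 < b by rewrite divr_gt0 // ltr_wpDl.
have bc : b * c = a q + 1 by rewrite /b divfK // gt_eqF.
have He' l : - b <= l <= b -> l * dotp q e <= a q + b * dotp q e ^+ 2.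
  move=> lb; rewrite -dotpZr; apply: (He b (ltW b0)) cPq.
  apply/(sum_segmentP _ _ _ _ (ltW b0)); exists l => //.
  by rewrite subrr; exact: PP_origin.
have H1 := He' b; have H2 := He' (- b).
suff : b * `|dotp q e| <= a q + b * dotp q e ^+ 2.
  by move: bc; rewrite /c; lra.
case: (ger0P (dotp q e)) => _; first by apply: H1; lra.
by rewrite mulrN -mulNr; apply: H2; lra.
Qed.

(** Were [<p, e> > 1], moving the facet of the sum slightly outwards would
    violate no constraint: constraints close to that of [p] keep the positive
    slack [<q, e> ^ 2 - <q, e>], and for the others the slack of [PP cP a]
    suffices. *)
Lemma facet_dotp_le1 e p : sum_within e -> sum_covers e ->
  facet_normals cP a p -> dotp p e <= 1.
Proof.
move=> Hin Hout Fp; rewrite leNgt; apply/negP => s1.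
have [p0 pv _] := Fp; have pp0 := dotpp_gt0 p0.
have [y [Py py yP]] := facet_relative_interior Fp.
have ap0 : 0 < a p.
  exact: symmetric_support_gt0 Pd cPN quad_formN p0 pv.
have bound w := facet_slack_bound w p0 yP.
have [K K0 KP] : exists2 K : 'rV[R]_d -> R, forall w, 0 <= K w &
    forall w q, cP q ->
    `|dotp (q - (dotp q p / dotp p p) *: p) w| <= K w * (a q - dotp q y).
  have /choice [K KP] : forall w, exists K : R, 0 <= K /\ forall q, cP q ->
    `|dotp (q - (dotp q p / dotp p p) *: p) w| <= K * (a q - dotp q y).
    by move=> w; have [K K0 KP] := bound w; exists K.
  by exists K => w; have [] := KP w.
(* [C] bounds [a q'], expanded along the standard basis, by the squared
   slack. *)
pose ej (j : 'I_d) : 'rV[R]_d := delta_mx 0 j.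
pose C := \sum_j K (ej j) * K (ej j *m A).
have C0 : 0 <= C by apply: sumr_ge0 => j _; apply: mulr_ge0.
have [h h0 hP] := slack_growth ap0 (K0 e) (K0 (p *m A)) (K0 y) C0 s1.
(* [y + e] lies on the facet of the sum with normal [p]. *)
have : PP cP (fun p => a p + rank1_form 1 e p) (y + e + (h / dotp p p) *: p).
  move=> q cPq; rewrite !dotpDr dotpZr /rank1_form mul1r.
  set t := dotp q p / dotp p p.
  have -> : h / dotp p p * dotp q p = h * t by rewrite /t; ring.
  have KPq w := KP w q cPq; rewrite -/t in KPq.
  pose q' := q - t *: p; have qE : q = t *: p + q' by rewrite addrC subrK.
  rewrite -/q' in KPq; clearbody q'.
  have r0 : 0 <= a q - dotp q y by rewrite subr_ge0 Py.
  have aq' : a q' <= C * (a q - dotp q y) ^+ 2.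
    rewrite aE [X in dotp X _]row_sum_delta dotp_suml /C mulr_suml.
    apply: ler_sum => j _; rewrite dotpZl dotp_mulmxC //.
    apply: le_trans (ler_norm _) _; rewrite normrM expr2 mulrACA.
    apply: ler_pM => //.
    have -> : q' 0 j = dotp q' (ej j).
      rewrite dotpC /ej dotpE -rowE !mxE //.
    exact: KPq.
  have q0 := sum_within_norm Hin cPq.
  have /hP hPt := r0.
  have := hPt t _ _ _ _ (KPq e) (KPq (p *m A)) (KPq y).
  have eqE : dotp q e = t * dotp p e + dotp q' e by rewrite qE dotpDl dotpZl.
  have q0' : 0 <= (t * dotp p e + dotp q' e) ^+ 2 - (t * dotp p e + dotp q' e).
    by rewrite subr_ge0 -eqE (le_trans (ler_norm _) q0).
  move=> /(_ (a q') _ _ q0'); rewrite a0 aq' -eqE => /(_ isT) H.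
  suff /H : a q - dotp q y = (t ^+ 2 - t) * a p + 2 * t * dotp q' (p *m A)
     + a q' - dotp q' y by lra.
  rewrite {1}aE {1 2 3}qE mulmxDl -scalemxAl !(dotpl, dotpr) py.
  by rewrite !aE (dotp_mulmxC p q') //; ring.
move=> /(Hout 1 ler01) /(sum_segmentP _ _ _ _ ler01) [l /andP [_ l1]] /(_ p).
move=> /(_ (FcP Fp)); rewrite !(dotpr) py mulfVK ?gt_eqF //.
by nra.
Qed.

Lemma sum_within_opp e : sum_within e -> sum_within (- e).
Proof.
move=> He b b0 z /(sum_segmentP _ _ _ _ b0) [l lb Pz] p cPp.
rewrite rank1_formN; apply: (He b b0 z) cPp.
apply/(sum_segmentP _ _ _ _ b0); exists (- l); first by lra.
by rewrite scaleNr -scalerN.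
Qed.

Lemma sum_covers_opp e : sum_covers e -> sum_covers (- e).
Proof.
move=> He b b0 z Pz; apply/(sum_segmentP _ _ _ _ b0).
have /(He b b0) /(sum_segmentP _ _ _ _ b0) [l lb Pl] :
    PP cP (fun p => a p + rank1_form b e p) z.
  by move=> p /Pz; rewrite rank1_formN.
exists (- l); first by lra.
by rewrite scaleNr scalerN opprK.
Qed.

Lemma sum_dual e : sum_within e -> sum_covers e -> dual (facet_normals cP a) e.
Proof.
move=> Hin Hout p Fp; rewrite dotpC.
have x1 := facet_dotp_le1 Hin Hout Fp.
have := facet_dotp_le1 (sum_within_opp Hin) (sum_covers_opp Hout) Fp.
rewrite dotpNr => x2.
have := sum_within_norm Hin (FcP Fp); move: x1 x2; set x := dotp p e.
have [x0|x0] := ger0P x => x1 x2 xx.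
  have /eqP : x * (x - 1) = 0 by nra.
  by rewrite mulf_eq0 subr_eq0 => /orP [] /eqP; [constructor 1 | constructor 2].
by constructor 3; nra.
Qed.

End SegmentDual.

(** * The form of a parallelotope is positive definite *)

Section IntegralSpan.
Variables (R : realType) (d : nat).
Implicit Types (S K : set 'rV[R]_d) (u v : 'rV[R]_d).

Lemma integral_span_min S K : S `<=` K -> K 0 ->
    (forall u v, K u -> K v -> K (u + v)) -> (forall u, K u -> K (- u)) ->
  integral_span S `<=` K.
Proof.
move=> SK K0 KD KN _ [n [c [v [Sv ->]]]].
apply: big_ind => // i _; have Kv := SK _ (Sv i).
have Kn m : K (v i *+ m) by elim: m => // m IH; rewrite mulrS; apply: KD.
by case: (c i) => m; [exact: Kn | apply/KN/Kn].
Qed.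

Lemma full_lattice_closed L : full_lattice L ->
  [/\ L 0, forall u v, L u -> L v -> L (u + v) & forall u, L u -> L (- u)].
Proof.
case=> B _ ->; split.
- by exists 0 => //; rewrite map_mx0 mul0mx.
- by move=> _ _ [z _ <-] [z' _ <-]; exists (z + z'); rewrite // map_mxD mulmxDl.
- by move=> _ [z _ <-]; exists (- z); rewrite // map_mxN mulNmx.
Qed.

End IntegralSpan.

(** Dirichlet's simultaneous approximation, by the pigeonhole principle on the
    fractional parts of the multiples of [x]. *)
Lemma dirichlet_approximation (R : realType) d (x : 'rV[R]_d) N :
  exists (k : nat) (z : 'rV[int]_d), (0 < k)%N /\
    forall j, `|k%:R * x 0 j - (z 0 j)%:~R| < N.+1%:R^-1.
Proof.
pose fr (k : nat) j : R := k%:R * x 0 j - (Num.floor (k%:R * x 0 j))%:~R.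
have fr01 k j : 0 <= fr k j < 1.
  by have := floor_itv (k%:R * x 0 j); rewrite /fr intrD; lra.
pose cell k j := Num.truncn (N.+1%:R * fr k j).
have N0 : 0 < N.+1%:R :> R by rewrite ltr0Sn.
have cellP k j : (cell k j)%:R <= N.+1%:R * fr k j < (cell k j).+1%:R.
  apply: truncn_itv; have /andP [f0 _] := fr01 k j.
  by rewrite mulr_ge0 // ltW.
have cellN k j : (cell k j < N.+1)%N.
  rewrite -(ltr_nat R); have /andP [lo _] := cellP k j.
  apply: le_lt_trans lo _; have /andP [_ f1] := fr01 k j.
  by rewrite -[ltRHS]mulr1 ltr_pM2l.
pose f (k : 'I_(N.+1 ^ d).+1) : {ffun 'I_d -> 'I_N.+1} :=
  [ffun j => Ordinal (cellN k j)].
have /injectivePn [k1 [k2 k12 fk]] : ~~ injectiveb f.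
  apply/negP => /injectiveP /leq_card.
  by rewrite card_ord card_ffun !card_ord ltnn.
wlog lt12 : k1 k2 k12 fk / (k1 < k2)%N.
  move=> H; case: (ltngtP k1 k2) => [|lt21|eq12]; first exact: H.
    by apply: (H k2 k1) => //; rewrite eq_sym.
  by move: k12; rewrite (ord_inj eq12) eqxx.
exists (k2 - k1)%N, (\row_j (Num.floor (k2%:R * x 0 j) - Num.floor (k1%:R * x 0 j))).
split; first by rewrite subn_gt0.
move=> j; rewrite mxE natrB ?(ltnW lt12) // intrB.
have -> : (k2%:R - k1%:R) * x 0 j - ((Num.floor (k2%:R * x 0 j))%:~R -
   (Num.floor (k1%:R * x 0 j))%:~R) = fr k2 j - fr k1 j by rewrite /fr; ring.
have c12 : cell k1 j = cell k2 j.
  by have /ffunP /(_ j) := fk; rewrite !ffunE => /(congr1 val).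
have := cellP k1 j; have := cellP k2 j; rewrite c12 -[(cell k2 j).+1%:R]natr1.
move: (cell k2 j)%:R => m P2 P1.
rewrite -[_^-1]mul1r ltr_pdivlMr // -[X in _ * X](gtr0_norm N0) -normrM.
by rewrite ltr_norml; lra.
Qed.

Section PositiveDefinite.
Variables (R : realType) (d : nat) (cP : set 'rV[R]_d) (A : 'M[R]_d).
Variable a : 'rV[R]_d -> R.
Implicit Types (e p q u v w x y z : 'rV[R]_d).
Hypotheses (cPN : symmetric_set cP) (AT : A^T = A).
Hypotheses (aE : forall p, a p = dotp p (p *m A)) (a0 : forall p, 0 <= a p).
Hypothesis Pd : affine_dim (PP cP a) d.
Hypothesis Llat : full_lattice (lattice cP a).
Hypothesis FC : facet_normals cP a `<=` contact_vectors cP a.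
Hypothesis CcP : contact_vectors cP a `<=` cP.

(** Minimality of [p] against [p + 2 u] and [p - 2 u]. *)
Lemma contact_dotp_bound p u : contact_vectors cP a p -> lattice cP a u ->
  `|dotp p (u *m A)| <= a u.
Proof.
move=> [_ pmin] Lu; have [_ _ LN] := full_lattice_closed Llat.
have q2 v : a (p + v *+ 2) = a p + 4 * dotp p (v *m A) + 4 * a v.
  rewrite !aE -scaler_nat mulmxDl -scalemxAl !(dotpl, dotpr).
  by rewrite (dotp_mulmxC v p) //; ring.
have := pmin _ Lu; have := pmin _ (LN _ Lu); rewrite !q2 mulNmx dotpNr.
by rewrite (quad_formN aE) ler_norml; lra.
Qed.

(** Linearity in [x] carries the bound over from the facet normals, where the
    constant is [1], to the lattice that they generate. *)
Lemma span_dotp_bound x : lattice cP a x ->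
  exists2 C : R, 0 <= C & forall u, lattice cP a u ->
    `|dotp x (u *m A)| <= C * a u.
Proof.
pose K : set 'rV[R]_d := [set x | exists2 C : R, 0 <= C &
  forall u, lattice cP a u -> `|dotp x (u *m A)| <= C * a u].
apply: (@integral_span_min _ _ _ K).
- move=> p Fp; exists 1 => // u Lu; rewrite mul1r.
  exact: contact_dotp_bound (FC Fp) Lu.
- by exists 0 => // u _; rewrite dotp0l normr0 mul0r.
- move=> u v [C C0 HC] [D D0 HD]; exists (C + D); first exact: addr_ge0.
  move=> w Lw; rewrite dotpDl mulrDl; apply: le_trans (ler_normD _ _) _.
  by apply: lerD; [exact: HC | exact: HD].
- by move=> u [C C0 HC]; exists C => // v Lv; rewrite dotpNl normrN; exact: HC.
Qed.

(** An isotropic lattice vector is a contact vector, hence a constraint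
    [<u, x> <= 0] on a symmetric body of full dimension. *)
Lemma lattice_isotropic u : lattice cP a u -> a u = 0 -> u = 0.
Proof.
move=> Lu au0; apply/eqP; apply: contraT => un0.
have cPu : cP u by apply: CcP; split=> // v _; rewrite au0.
have /(symmetric_support_gt0 Pd cPN (quad_formN aE) un0) :
  forall x, PP cP a x -> dotp u x <= a u by move=> x; exact.
by rewrite au0 ltxx.
Qed.

(** If the form had a kernel vector [v], some nonzero lattice vector [u] would
    be close to a multiple of [v]; as [a u] is controlled by the products
    [B (x, u)] with [x] in the lattice, and these in turn by [a u], closeness
    forces [a u = 0]. *)
Lemma form_unitmx : A \in unitmx.
Proof.
have [B Bu LE] := Llat.
rewrite -row_free_unit -kermx_eq0; apply: contraT => /rowV0Pn [v /sub_kermxP vA v0].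
pose nu := v *m invmx B.
have nu0 : nu != 0.
  by apply: contraNneq v0 => nu0; rewrite -(mulmxKV Bu v) -/nu nu0 mul0mx.
have /rV0Pn [j0 nuj0] := nu0.
(* A coordinate equal to [1] keeps the multiples of [x] away from [0], hence
   the approximating integral vector is not [0]. *)
pose x := (nu 0 j0)^-1 *: nu.
have xBA : x *m B *m A = 0.
  by rewrite -!scalemxAl (mulmxKV Bu) vA scaler0.
have xj0 : x 0 j0 = 1 by rewrite mxE mulVf.
clearbody x.
have LB i : lattice cP a (row i B).
  rewrite LE; exists (delta_mx 0 i) => //.
  by rewrite rowE; congr (_ *m _); apply/matrixP => i' j'; rewrite !mxE; case: (_ && _).
have /choice [C CP] : forall i, exists C : R, 0 <= C /\ forall u, lattice cP a u ->
    `|dotp (row i B) (u *m A)| <= C * a u.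
  by move=> i; have [C C0 HC] := span_dotp_bound (LB i); exists C.
have C0 i : 0 <= C i by have [] := CP i.
pose S := \sum_i C i; have S0 : 0 <= S by apply: sumr_ge0.
pose N := Num.truncn S.
have SN : S < N.+1%:R by have /andP [] := truncn_itv S0.
have N0 : 0 < N.+1%:R :> R by rewrite ltr0Sn.
have [k [z [k0 kz]]] := dirichlet_approximation x N.
pose u := map_mx intr z *m B.
have Lu : lattice cP a u by rewrite LE; exists z.
pose dl := map_mx intr z - k%:R *: x.
have uE : u = (k%:R *: x) *m B + dl *m B by rewrite -mulmxDl addrC subrK.
have dlN j : `|dl 0 j| <= N.+1%:R^-1.
  by rewrite !mxE distrC; apply: ltW; exact: kz.
(* [a u = B (dl, u)], and the coordinates of [dl] are small enough to make
   this at most a proper fraction of [a u]. *)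
have au0 : a u = 0.
  have : a u <= S / N.+1%:R * a u.
    rewrite {1}aE {1}uE dotpDl -!scalemxAl dotpZl dotp_mulmxC // xBA dotp0r.
    rewrite mulr0 add0r dotpC dotp_mulmx -mulrA mulr_suml.
    apply: ler_sum => i _; apply: le_trans (ler_norm _) _; rewrite normrM.
    rewrite mulrCA; apply: ler_pM => //; rewrite dotpC; exact: (CP i).2.
  have : 0 < 1 - S / N.+1%:R by rewrite subr_gt0 ltr_pdivrMr // mul1r.
  move=> lt1 le1; apply/eqP; rewrite eq_le a0 andbT -(pmulr_rle0 _ lt1).
  by rewrite mulrBl mul1r subr_le0.
have u0 := lattice_isotropic Lu au0.
have z0 : map_mx intr z = 0 :> 'rV[R]_d.
  by rewrite -(mulmxK Bu (map_mx intr z)) -/u u0 mul0mx.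
have := kz j0; rewrite xj0 mulr1.
have -> : z 0 j0 = 0.
  by move/matrixP: z0 => /(_ 0 j0); rewrite !mxE => /eqP; rewrite intr_eq0 => /eqP.
rewrite subr0 normr_nat => /lt_le_trans /(_ (_ : _ <= 1)).
by rewrite invf_le1 // ler1n => /(_ isT); rewrite ltrn1 ltnNge k0.
Qed.

End PositiveDefinite.

(** * Local finiteness of the lattice *)

Lemma seq_argmin (R : realDomainType) (T : eqType) (f : T -> R) (s : seq T) x0 :
  x0 \in s -> exists2 x, x \in s & forall y, y \in s -> f x <= f y.
Proof.
elim: s x0 => // t s IH x0 _; case: s IH => [|t' s] IH.
  by exists t; rewrite ?mem_head // => y; rewrite inE => /eqP ->.
have [x xs xmin] := IH t' (mem_head _ _).
have [tx|xt] := leP (f t) (f x).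
  exists t; rewrite ?mem_head // => y; rewrite inE => /predU1P [-> //|ys].
  exact: le_trans tx (xmin y ys).
exists x; first by rewrite inE xs orbT.
by move=> y; rewrite inE => /predU1P [->|/xmin //]; exact: ltW.
Qed.

Lemma seq_positive_min (R : realFieldType) (T : eqType) (f : T -> R) (C : set T)
    (s : seq T) : (forall x, C x -> 0 < f x) ->
  exists2 m : R, 0 < m & forall x, x \in s -> C x -> m <= f x.
Proof.
move=> f0; elim: s => [|t s [m m0 ms]]; first by exists 1.
have [Ct|nCt] := pselect (C t).
  exists (Num.min m (f t)); first by rewrite lt_min m0 f0.
  move=> x; rewrite inE => /predU1P [->|xs] Cx; first by rewrite ge_min lexx orbT.
  by rewrite ge_min ms.
by exists m => // x; rewrite inE => /predU1P [->|xs] Cx //; apply: ms.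
Qed.

Section LocalFiniteness.
Variables (R : realType) (d : nat) (L : set 'rV[R]_d) (A : 'M[R]_d).
Variable a : 'rV[R]_d -> R.
Implicit Types (p q u v x y z : 'rV[R]_d) (C : set 'rV[R]_d).
Hypotheses (AT : A^T = A) (Au : A \in unitmx).
Hypotheses (aE : forall p, a p = dotp p (p *m A)) (a0 : forall p, 0 <= a p).
Hypothesis Llat : full_lattice L.

Lemma form_eq0 u : a u = 0 -> u = 0.
Proof.
rewrite aE => u0; rewrite -(mulmxK Au u) (psd_kernel AT _ u0) ?mul0mx //.
by move=> w; rewrite -aE.
Qed.

Lemma dotp_form_bound u x : dotp u x ^+ 2 <= a u * a (x *m invmx A).
Proof.
rewrite -{1}(mulmxKV Au x) !aE; apply: psd_cauchy_schwarz => // w.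
by rewrite -aE.
Qed.

(** By Cauchy-Schwarz each coordinate of a vector is bounded by its norm. *)
Lemma ball_finite M : exists s : seq 'rV[R]_d,
  forall u, L u -> a u <= M -> u \in s.
Proof.
have [B Bu LE] := Llat.
pose w j := (col j (invmx B))^T.
pose K := \sum_j a (w j *m invmx A).
have K0 : 0 <= K by apply: sumr_ge0.
have MK0 : 0 <= `|M| * K by rewrite mulr_ge0.
pose N := Num.bound (`|M| * K).
have KN : `|M| * K < N%:R by have := archi_boundP MK0.
pose pt (f : {ffun 'I_d -> 'I_(N + N).+1}) : 'rV[R]_d :=
  map_mx intr (\row_j ((f j)%:Z - N%:Z)) *m B.
exists [seq pt f | f <- enum {ffun 'I_d -> 'I_(N + N).+1}] => u0.
rewrite LE => -[z _ <-] {u0}; set u := _ *m B => auM.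
have zw j : (z 0 j)%:~R = dotp u (w j).
  rewrite dotpE /w trmxK colE mulmxA mulmxK //.
  by rewrite -colE !mxE.
have zN j : `|z 0 j| <= N%:Z.
  have : (z 0 j)%:~R ^+ 2 <= N%:R :> R.
    rewrite zw; apply: le_trans (dotp_form_bound _ _) _.
    apply: le_trans (ltW KN); apply: ler_pM => //.
      exact: le_trans auM (ler_norm _).
    rewrite /K (bigD1 j) //= lerDl; exact: sumr_ge0.
  rewrite -[N%:R]/(N%:Z%:~R) -rmorphXn /= ler_int => zN2.
  nia.
apply/mapP; exists [ffun j => inord (absz (z 0 j + N%:Z))].
  by rewrite mem_enum.
rewrite /u /pt; congr (map_mx _ _ *m B); apply/rowP => j.
rewrite mxE ffunE inordK; have := zN j; lia.
Qed.

Lemma lattice_argmin C u0 : C `<=` L -> C u0 ->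
  exists2 u, C u & forall v, C v -> a u <= a v.
Proof.
move=> CL Cu0; have [s sP] := ball_finite (a u0).
pose s' := [seq u <- s | `[< C u >]].
have s'P v : C v -> a v <= a u0 -> v \in s'.
  by move=> Cv av; rewrite mem_filter (sP _ (CL _ Cv) av) andbT; apply/asboolP.
have [u us umin] := seq_argmin a (s'P _ Cu0 (lexx _)).
move: us; rewrite mem_filter => /andP [/asboolP Cu _]; exists u => // v Cv.
have [vu|/ltW uv] := leP (a v) (a u0); first exact/umin/s'P.
exact: le_trans (umin _ (s'P _ Cu0 (lexx _))) uv.
Qed.

Lemma lattice_ind (Q : set 'rV[R]_d) :
  (forall u, L u -> (forall v, L v -> a v < a u -> Q v) -> Q u) ->
  forall u, L u -> Q u.
Proof.
move=> IH u0 Lu0; apply: contrapT => nQ.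
have [||u [Lu nQu] umin] := @lattice_argmin (L `&` ~` Q) u0; [by move=> ? [] | by [] |].
apply/nQu/IH => // v Lv vu; apply: contrapT => nQv.
by have := umin v (conj Lv nQv); rewrite leNgt vu.
Qed.

(** Only finitely many constraints can become violated within a bounded
    distance, because the right-hand sides grow quadratically. *)
Lemma slack_perturbation C g y x : C `<=` L -> (forall q, C q -> a q <= g q) ->
    (forall q, C q -> dotp q y < g q) ->
  exists2 h : R, 0 < h & forall q, C q -> h * `|dotp q x| <= g q - dotp q y.
Proof.
move=> CL ag Cy.
pose M := a ((y + x) *m invmx A) + a ((y - x) *m invmx A).
have [s sP] := ball_finite M.
pose f q := (g q - dotp q y) / (1 + `|dotp q x|).
have den q : 0 < 1 + `|dotp q x| by rewrite ltr_wpDr.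
have f0 q : C q -> 0 < f q by move=> Cq; rewrite divr_gt0 // subr_gt0 Cy.
have [m m0 ms] := seq_positive_min s f0.
exists (Num.min 1 m) => [|q Cq]; first by rewrite lt_min ltr01.
have [aqM|Maq] := leP (a q) M.
  have := ms q (sP q (CL q Cq) aqM) Cq; rewrite ler_pdivlMr // => mq.
  apply: le_trans mq; apply: ler_pM => //.
  - by rewrite le_min ler01 ltW.
  - by rewrite ge_min lexx orbT.
  - by rewrite lerDr.
suff far z : a (z *m invmx A) <= M -> dotp q z <= g q.
  have := far (y + x); have := far (y - x).
  rewrite lerDl lerDr !a0 !dotpr => /(_ isT) H1 /(_ isT) H2.
  apply: (@le_trans _ _ `|dotp q x|); last by rewrite ler_norml; lra.
  by rewrite ler_piMl // ge_min lexx.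
move=> zM; apply: le_trans (ag q Cq).
have {zM Maq} : a (z *m invmx A) < a q by exact: le_lt_trans Maq.
have := dotp_form_bound q z; have := a0 q.
move: (a q) (a (z *m _)) (dotp q z) => r k t r0 cs kr.
by rewrite leNgt; apply/negP => rt; nra.
Qed.

End LocalFiniteness.

(** * Minimal vectors of the parity classes *)

Section ParityClasses.
Variables (R : realType) (d : nat) (cP : set 'rV[R]_d) (A : 'M[R]_d).
Variables (a : 'rV[R]_d -> R) (e : 'rV[R]_d).
Implicit Types (p q s t u v w x y z : 'rV[R]_d).
Hypotheses (cPN : symmetric_set cP) (AT : A^T = A).
Hypotheses (aE : forall p, a p = dotp p (p *m A)) (a0 : forall p, 0 <= a p).
Hypothesis Pd : affine_dim (PP cP a) d.
Hypothesis Llat : full_lattice (lattice cP a).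
Hypothesis FC : facet_normals cP a `<=` contact_vectors cP a.
Hypothesis CcP : contact_vectors cP a `<=` cP.
Hypothesis cPL : cP `<=` lattice cP a.
Hypothesis eD : dual (facet_normals cP a) e.

Local Notation L := (lattice cP a).
Local Notation contact := (contact_vectors cP a).

Let Au : A \in unitmx := form_unitmx cPN AT aE a0 Pd Llat FC CcP.
Let L0 : L 0 := let: And3 h _ _ := full_lattice_closed Llat in h.
Let LD : forall u v, L u -> L v -> L (u + v) :=
  let: And3 _ h _ := full_lattice_closed Llat in h.
Let LN : forall u, L u -> L (- u) :=
  let: And3 _ _ h := full_lattice_closed Llat in h.

Lemma form_parallelogram u v : a (u + v) + a (u - v) = 2 * (a u + a v).
Proof. by rewrite !aE quad_parallelogram. Qed.

Lemma lattice_dotp_int u : L u -> exists n : int, dotp u e = n%:~R.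
Proof.
apply: (@integral_span_min _ _ _ [set u | exists n : int, dotp u e = n%:~R]).
- move=> p Fp /=; rewrite dotpC.
  by case: (eD Fp) => ->; [exists 0 | exists 1 | exists (-1)].
- by exists 0; rewrite dotp0l.
- by move=> x y [m xm] [n yn]; exists (m + n); rewrite dotpDl xm yn intrD.
- by move=> x [m xm]; exists (- m); rewrite dotpNl xm intrN.
Qed.

Lemma contact_lattice u : contact u -> L u.
Proof. by case. Qed.

Lemma contact_same_norm u v : contact u -> L v -> a (u + v *+ 2) = a u ->
  contact (u + v *+ 2).
Proof.
move=> [Lu umin] Lv auv; split; first by apply/LD => //; rewrite mulr2n; apply: LD.
by move=> w Lw; rewrite auv -addrA -mulrnDl; apply/umin/LD.
Qed.

(** Half of Voronoi's characterisation of the facet normals: at the point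
    [u *m A] every other constraint has positive slack. *)
Lemma unique_minimum_facet u : contact u -> u != 0 ->
    (forall v, L v -> a (u + v *+ 2) = a u -> v = 0 \/ v = - u) ->
  facet_normals cP a u.
Proof.
move=> cu un0 uniq; have [Lu umin] := cu.
pose y := u *m A; have [M Mfree Mu] := hyperplane_basis un0.
pose C := cP `&` [set q | q != 0 /\ q != u].
have slack q : C q -> dotp q y < a q.
  case=> /cPL Lq [qn0 qnu]; have Lqu := LD Lq (LN Lu).
  have : a (u + (q - u) *+ 2) != a u.
    apply: contraNneq qn0 => /uniq [//|/eqP|/eqP].
      by rewrite subr_eq0 (negPf qnu).
    by rewrite -subr_eq0 opprK subrK.
  have := umin _ Lqu; rewrite le_eqVlt eq_sym => /orP [->//|+ _].
  (* The slack of [q] is a quarter of [a (q + (q - u)) - a u]. *)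
  have -> : u + (q - u) *+ 2 = q + (q - u).
    by rewrite mulr2n addrA (addrC u) subrK.
  have := form_parallelogram q (q - u).
  have -> : q - (q - u) = u by rewrite opprB addrC subrK.
  have -> : a (q - u) = a q + a u - 2 * dotp q y.
    rewrite !aE mulmxBl !(dotpl, dotpr) (dotp_mulmxC u q) //; ring.
  lra.
have CL : C `<=` L by move=> q [/cPL].
(* A common scale for all edges of the frame, smaller than every [h i]. *)
have /choice [h hP] : forall i, exists h : R, 0 < h /\
    forall q, C q -> h * `|dotp q (row i M)| <= a q - dotp q y.
  move=> i; have [//|h h0 hP] :=
    slack_perturbation AT Au aE a0 Llat (row i M) CL _ slack.
  by exists h.
pose r := (1 + \sum_i (h i)^-1)^-1.
have hV i : 0 < (h i)^-1 by rewrite invr_gt0 (hP i).1.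
have S0 : 0 <= \sum_i (h i)^-1 by apply: sumr_ge0 => i _; exact: ltW.
have r0 : 0 < r by rewrite invr_gt0 ltr_wpDr.
have rh i : r <= h i.
  rewrite -[h i]invrK lef_pV2 ?posrE ?ltr_wpDr //.
  rewrite (bigD1 i) //= addrCA lerDl addr_ge0 // sumr_ge0 // => j _.
  exact: ltW.
have uy : dotp u y = a u by rewrite aE.
have Py q w : cP q -> (q = u -> dotp u w = 0) ->
    (C q -> `|dotp q w| <= a q - dotp q y) -> dotp q (y + w) <= a q.
  move=> cPq qu Cq; have [->|qn0] := eqVneq q 0; first by rewrite dotp0l.
  have [qe|qnu] := eqVneq q u.
    by rewrite qe dotpDr uy (qu qe) addr0.
  have /ler_normlP [_] := Cq (conj cPq (conj qn0 qnu)).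
  by rewrite dotpDr; lra.
apply: (@facet_normalsI _ _ _ _ _ y (r *: M)) => //.
- by move=> x; apply; apply: CcP.
- by rewrite /row_free (eqmx_scale _ (lt0r_neq0 r0)) (eqP Mfree).
- by move=> i; rewrite linearZ dotpZr Mu mulr0.
- move=> q cPq; rewrite -[y]addr0; apply: Py => //; first by rewrite dotp0r.
  by move=> /slack; rewrite dotp0r normr0; lra.
- move=> i q cPq; apply: Py => //; first by rewrite linearZ dotpZr Mu mulr0.
  move=> Cq; apply: le_trans ((hP i).2 q Cq).
  by rewrite linearZ dotpZr normrM gtr0_norm // ler_wpM2r.
Qed.

Let form_eq0L := form_eq0 AT Au aE a0.

Lemma form_lt u v : v != 0 -> a u + a v <= a (u + v) -> a u < a (u + v).
Proof.
move=> v0; apply: lt_le_trans; rewrite ltrDl lt_def a0 andbT.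
by apply: contraNneq v0 => /form_eq0L ->.
Qed.

(** A representative of the class of [s] shorter than [s] would, with [t], give a
    sum or a difference shorter than [s + t] and in its class. *)
Lemma contact_summand s t : contact (s + t) -> L s -> L t ->
  a (s + t) = a s + a t -> contact s.
Proof.
move=> [_ stmin] Ls Lt ast; split=> // w Lw.
have := form_parallelogram (s + w *+ 2) t.
have := stmin _ Lw; have := stmin _ (LD Lw (LN Lt)).
have -> : s + t + (w - t) *+ 2 = s + w *+ 2 - t.
  by apply/rowP => i; rewrite !mulr2n !mxE; ring.
have -> : s + t + w *+ 2 = s + w *+ 2 + t by rewrite addrAC.
lra.
Qed.

(** A contact vector which is not a facet normal is an orthogonal sum of two
    shorter contact vectors, along which the functional [e] can be reduced
    separately. *)
Lemma contact_dotp_le1 u : L u -> contact u ->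
  exists2 v, L v & contact (u + v *+ 2) /\ `|dotp (u + v *+ 2) e| <= 1.
Proof.
apply: (lattice_ind AT Au aE a0 Llat (Q := fun u => contact u -> exists2 v, L v &
  contact (u + v *+ 2) /\ `|dotp (u + v *+ 2) e| <= 1)) => {}u Lu IH cu.
have [u1|u1] := lerP `|dotp u e| 1.
  by exists 0 => //; rewrite mul0rn addr0.
have u0 : u != 0.
  by apply: contraTneq u1 => ->; rewrite dotp0l normr0 -leNgt.
have [uniq|] := pselect (forall v, L v -> a (u + v *+ 2) = a u -> v = 0 \/ v = - u).
  have := eD (unique_minimum_facet cu u0 uniq); rewrite dotpC => u01.
  by move: u1; case: u01 => ->; rewrite ?normrN ?normr0 ?normr1; lra.
move=> /existsNP [v /not_implyP [Lv /not_implyP [auv /not_orP [/eqP v0 /eqP vu]]]].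
(* [s] and [t] are orthogonal because [s + t] and [s - t] have equal norms. *)
pose s := u + v; pose t := - v.
have Ls : L s by exact: LD.
have Lt : L t by exact: LN.
have us : u = s + t by rewrite /s /t addrK.
have uv : u + v *+ 2 = s - t by rewrite /s /t opprK mulr2n addrA.
have s0 : s != 0 by rewrite /s addrC addr_eq0.
have t0 : t != 0 by rewrite /t oppr_eq0.
have ast : a (s + t) = a s + a t.
  by have := form_parallelogram s t; rewrite -uv auv -us; lra.
have cst : contact (s + t) by rewrite -us.
have cs := contact_summand cst Ls Lt ast.
have ct : contact t.
  by apply: (@contact_summand t s) => //; rewrite addrC // ast addrC.
have [|v1 Lv1 [cs1 s1]] := IH s Ls _ cs.
  by rewrite us form_lt // ast.
have [|v2 Lv2 [ct2 t2]] := IH t Lt _ ct.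
  by rewrite us addrC form_lt // (addrC t s) ast addrC.
clearbody s t.
have same p w : contact p -> L w -> contact (p + w *+ 2) -> a (p + w *+ 2) = a p.
  move=> [_ pmin] Lw [_ /(_ _ (LN Lw))]; rewrite mulNrn addrK => le1.
  by apply/eqP; rewrite eq_le le1 pmin.
have as1 := same _ _ cs Lv1 cs1; have at2 := same _ _ ct Lv2 ct2.
set s' := s + v1 *+ 2 in cs1 s1 as1; set t' := t + v2 *+ 2 in ct2 t2 at2.
(* Both [s' + t'] and [s' - t'] lie in the class of [u] and are minimal there,
   as their norms add up to twice the minimum. *)
pose w1 := v1 + v2; pose w2 := v1 - v2 - t.
have Lw1 : L w1 by exact: LD.
have Lw2 : L w2 by apply: LD; [apply: LD => //; exact: LN | exact: LN].
have w1E : u + w1 *+ 2 = s' + t'.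
  by rewrite us /w1 mulrnDl addrACA.
have w2E : u + w2 *+ 2 = s' - t'.
  by rewrite us /s' /t' /w2; apply/rowP => i; rewrite !mulr2n !mxE; ring.
have := form_parallelogram s' t'.
have := cu.2 _ Lw1; have := cu.2 _ Lw2; rewrite w1E w2E us ast as1 at2 => m2 m1 pl.
have a1 : a (u + w1 *+ 2) = a u by rewrite w1E us ast; lra.
have a2 : a (u + w2 *+ 2) = a u by rewrite w2E us ast; lra.
rewrite -us.
have [le1|gt1] := lerP `|dotp (u + w1 *+ 2) e| 1.
  by exists w1 => //; split; [exact: contact_same_norm cu Lw1 a1 | ].
exists w2 => //; split; first exact: contact_same_norm cu Lw2 a2.
move: gt1 s1 t2; rewrite w1E w2E !dotpl.
by move: (dotp s' e) (dotp t' e) => x y; rewrite !ler_norml ltNge ler_norml; lra.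
Qed.

Lemma parity_class_small q : L q ->
  exists2 v, L v & contact (q + v *+ 2) /\ `|dotp (q + v *+ 2) e| <= 1.
Proof.
move=> Lq; pose C : set 'rV[R]_d := [set u | exists2 v, L v & u = q + v *+ 2].
have CL : C `<=` L.
  by move=> _ [v Lv ->]; apply: LD => //; rewrite mulr2n; exact: LD.
have [|u [v Lv ue] umin] := @lattice_argmin _ _ L A a AT Au aE a0 Llat C q CL.
  by exists 0; rewrite // mul0rn addr0.
have cu : contact u.
  split=> [|w Lw]; first by apply: CL; exists v.
  by apply: umin; exists (v + w); [exact: LD | rewrite ue mulrnDl -addrA].
have [w Lw] := contact_dotp_le1 (contact_lattice cu) cu.
rewrite ue -addrA -mulrnDl => cw; exists (v + w) => //; exact: LD.
Qed.

Lemma rank1_form_ge0 b q : 0 <= b -> 0 <= rank1_form b e q.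
Proof. by move=> b0; rewrite mulr_ge0 ?sqr_ge0. Qed.

(** Congruent integers modulo 2, the first of them in {-1, 0, 1}. *)
Lemma parity_sqr_le q v : L q -> L v -> `|dotp (q + v *+ 2) e| <= 1 ->
  dotp (q + v *+ 2) e ^+ 2 <= dotp q e ^+ 2.
Proof.
move=> Lq Lv; have [n qn] := lattice_dotp_int Lq.
have [m vm] := lattice_dotp_int Lv.
have -> : dotp (q + v *+ 2) e = (n + m *+ 2)%:~R.
  by rewrite dotpDl dotpMnl qn vm intrD rmorphMn.
rewrite qn -intr_norm -!rmorphXn /= ler_int (ler_int _ _ 1) => le1.
rewrite -[leLHS]real_normK ?num_real // -[leRHS]real_normK ?num_real //.
by rewrite lerXn2r ?nnegrE //; lia.
Qed.

(** If [u] represents the class of [q], then [q] is the sum of [(q + u) / 2] and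
    [(q - u) / 2], which are shorter than [q]; the parallelogram law turns their
    constraints into that of [q]. *)
Lemma constraint_descent b y : 0 <= b ->
    (forall u, contact u -> `|dotp u e| <= 1 ->
       dotp u y <= a u + rank1_form b e u) ->
  forall q, L q -> dotp q y <= a q + rank1_form b e q.
Proof.
move=> b0 Hy; apply: (lattice_ind AT Au aE a0 Llat) => q Lq IH.
have [v Lv [cu u1]] := parity_class_small Lq.
set u := q + v *+ 2 in cu u1.
have au : a u <= a q by have := cu.2 _ (LN Lv); rewrite mulNrn addrK.
have eu : dotp u e ^+ 2 <= dotp q e ^+ 2 by exact: parity_sqr_le.
have uq : q + v + (- v) = q by rewrite addrK.
have uu : q + v - (- v) = u by rewrite opprK -addrA -mulr2n.
have same : a u = a q -> dotp u e ^+ 2 = dotp q e ^+ 2 -> u = q \/ u = - q ->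
    dotp q y <= a q + rank1_form b e q.
  move=> aq eq2 uqq; rewrite /rank1_form -eq2 -aq.
  have cq : contact q.
    split=> // w Lw; rewrite -aq.
    have -> : q + w *+ 2 = u + (w - v) *+ 2.
      by rewrite /u mulrnBl addrAC -addrA subrK // addrAC.
    exact/cu.2/LD/LN.
  rewrite aq eq2; apply: Hy => //.
  by case: uqq u1 => ->; rewrite // dotpNl normrN.
have [v0|v0] := eqVneq v 0.
  by apply: same; rewrite ?/u v0 mul0rn addr0 //; left.
have [qv0|qv0] := eqVneq (q + v) 0.
  have uNq : u = - q.
    by rewrite -uu qv0 sub0r opprK -[v](addKr q) qv0 addr0.
  apply: same; last by right.
    by rewrite uNq (quad_formN aE).
  by rewrite uNq dotpNl sqrrN.
have pl := form_parallelogram (q + v) (- v); rewrite uq uu in pl.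
have pos w : w != 0 -> 0 < a w.
  by move=> w0; rewrite lt_def a0 andbT; apply: contraNneq w0 => /form_eq0L ->.
have Nv0 : - v != 0 by rewrite oppr_eq0.
have p1 := pos _ qv0; have p2 := pos _ Nv0.
have H1 : dotp (q + v) y <= a (q + v) + rank1_form b e (q + v).
  by apply: IH; [exact: LD | lra].
have H2 : dotp (- v) y <= a (- v) + rank1_form b e (- v).
  by apply: IH; [exact: LN | lra].
have pe : dotp q e ^+ 2 + dotp u e ^+ 2 =
    2 * (dotp (q + v) e ^+ 2 + dotp (- v) e ^+ 2).
  by rewrite -{1}uq -uu !dotpDl !dotpNl; ring.
rewrite -{1}uq dotpDl; apply: le_trans (lerD H1 H2) _.
rewrite /rank1_form; have := ler_wpM2l b0 eu; have := f_equal (fun c : R => b * c) pe.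
by rewrite !mulrDr; lra.
Qed.

(** The constraints with [<v, e> = 1] bound the shift of [z] along [e] from below,
    those with [<w, e> = -1] from above.  By parity, the representative [u] of
    the class of [v - w] is orthogonal to [e]; hence so are [(v + w + u) / 2] and
    [(v + w - u) / 2], at which the forms of the sum and of the summand agree.
    Adding up their constraints gives the claim. *)
Lemma shift_compatible b z v w : 0 <= b ->
    PP cP (fun p => a p + rank1_form b e p) z ->
    L v -> dotp v e = 1 -> L w -> dotp w e = -1 ->
  dotp v z - a v <= a w - dotp w z.
Proof.
move=> b0 Pz Lv ev Lw ew; have Lvw := LD Lv (LN Lw).
have [k Lk [cu u1]] := parity_class_small Lvw.
set u := v - w + k *+ 2 in cu u1.
have [m km] := lattice_dotp_int Lk.
have eu : dotp u e = 0.
  move: u1; rewrite /u dotpDl dotpMnl dotpDl dotpNl ev ew km opprK.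
  have -> : 1 + 1 + m%:~R *+ 2 = ((1 + m) *+ 2)%:~R :> R.
    by rewrite rmorphMn /= intrD mulrnDl mulr2n.
  rewrite -intr_norm (ler_int _ _ 1) => le1.
  by have -> : (1 + m) *+ 2 = 0 :> int by lia.
have Hb q : L q -> dotp q z <= a q + rank1_form b e q.
  by apply: constraint_descent => // p cp _; apply/Pz/CcP.
have ek : dotp k e = -1.
  by move: eu; rewrite /u dotpDl dotpMnl dotpDl dotpNl ev ew; lra.
have := Hb _ (LD Lv Lk); have := Hb _ (LD Lw (LN Lk)).
rewrite /rank1_form !dotpDl !dotpNl ek ev ew.
have := form_parallelogram (v + k) (w - k).
have -> : v + k + (w - k) = v + w by rewrite addrACA subrr addr0.
have -> : v + k - (w - k) = u.
  by apply/rowP => i; rewrite /u mulr2n !mxE; ring.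
have := form_parallelogram v w.
have := cu.2 _ (LN Lk); rewrite mulNrn addrK.
lra.
Qed.

(** The shift is the least one that satisfies the lower bounds, including
    [- b]. *)
Lemma sum_covers_lattice : sum_covers cP a e.
Proof.
move=> b b0 z Pz; apply/sum_segmentP => //.
pose E : set R := [set x | x = - b \/ exists2 v, contact v &
  dotp v e = 1 /\ x = dotp v z - a v].
have E0 : E !=set0 by exists (- b); left.
have EbP v : contact v -> dotp v e ^+ 2 = 1 -> dotp v z - a v <= b.
  by move=> /CcP /Pz; rewrite /rank1_form => + e1; rewrite e1; lra.
have Eub : ubound E b.
  move=> x [->|[v cv [ev ->]]]; first by lra.
  by apply: EbP; rewrite // ev expr1n.
have Eb : has_ubound E by exists b.
exists (sup E).
  by rewrite (ub_le_sup Eb) /=; [exact: ge_sup | left].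
suff H q : L q -> dotp q (z - sup E *: e) <= a q + rank1_form 0 e q.
  by move=> q /cPL /H; rewrite /rank1_form mul0r addr0.
apply: constraint_descent => // u cu u1; rewrite /rank1_form mul0r addr0.
rewrite dotpDr dotpNr dotpZr.
have [n un] := lattice_dotp_int cu.1.
have : [\/ n = 0, n = 1 | n = -1].
  move: u1; rewrite un -intr_norm (ler_int _ _ 1) => n1.
  have : n = 0 \/ n = 1 \/ n = -1 by lia.
  by move=> [|[]]; [constructor 1 | constructor 2 | constructor 3].
case=> n0; rewrite n0 in un; rewrite un.
- have := Pz _ (CcP cu); rewrite /rank1_form un; lra.
- suff : dotp u z - a u <= sup E by lra.
  by apply: (ub_le_sup Eb); right; exists u.
- suff : sup E <= a u - dotp u z by lra.
  apply: ge_sup => // x [->|[v cv [ev ->]]].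
    by have := EbP u cu; rewrite un sqrrN expr1n => /(_ erefl); lra.
  by apply: shift_compatible Pz cv.1 ev cu.1 un.
Qed.

Lemma sum_within_lattice : sum_within cP a e.
Proof.
move=> b b0 z /(sum_segmentP _ _ _ _ b0) [l lb Pz] q cPq.
have := Pz q cPq; rewrite dotpDr dotpNr dotpZr /rank1_form.
have [n ->] := lattice_dotp_int (cPL cPq).
have n1 : `|n%:~R| <= n%:~R ^+ 2 :> R.
  by rewrite -intr_norm -rmorphXn /= ler_int; nia.
have : l * n%:~R <= b * n%:~R ^+ 2.
  apply: le_trans (ler_norm _) _; rewrite normrM ler_pM // ler_norml.
  by lra.
lra.
Qed.

End ParityClasses.

(** * The sum with a dual segment is a parallelotope *)

(** The vertices are duplicated, one copy for each end of the segment. *)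
Lemma polytope_add_segment (R : realType) d (Q : set 'rV[R]_d) (b : R) e :
  is_polytope Q -> is_polytope (minkowski Q (dilate b (segment e))).
Proof.
move=> [n [v ->]]; pose f := b *: e.
exists (n + n)%N, (fun i => match split i with
  inl j => v j + f | inr j => v j - f end).
apply/seteqP; split=> [_ [x [w [w0 w1 ->]] [_ [_ [l /= l1 <-] <-] <-]]|].
  exists (fun i => match split i with
    inl j => w j * ((1 + l) / 2) | inr j => w j * ((1 - l) / 2) end); split.
  - by move=> i; case: split => j; rewrite mulr_ge0 //; lra.
  - rewrite big_split_ord /=.
    under eq_bigr do rewrite -[lshift _ _]/(unsplit (inl _)) unsplitK.
    under [X in _ + X]eq_bigr do rewrite -[rshift _ _]/(unsplit (inr _)) unsplitK.
    by rewrite -!mulr_suml w1; lra.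
  - transitivity (\sum_i (w i * ((1 + l) / 2)) *: (v i + f)
        + \sum_i (w i * ((1 - l) / 2)) *: (v i - f)).
      have -> : b *: (l *: e) = \sum_i w i *: (l *: f).
        by rewrite -scaler_suml w1 scale1r /f !scalerA mulrC.
      rewrite -!big_split /=; apply: eq_bigr => i _.
      by apply/rowP => j; rewrite !mxE; lra.
    rewrite big_split_ord /=; congr (_ + _); apply: eq_bigr => i _.
      by rewrite -[lshift _ _]/(unsplit (inl _)) unsplitK.
    by rewrite -[rshift _ _]/(unsplit (inr _)) unsplitK.
move=> _ [w [w0 w1 ->]].
pose wl i := w (lshift n i); pose wr i := w (rshift n i).
have -> : \sum_i w i *: match split i with inl j => v j + f | inr j => v j - f end
    = \sum_i wl i *: (v i + f) + \sum_i wr i *: (v i - f).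
  rewrite big_split_ord /=; congr (_ + _); apply: eq_bigr => i _.
    by rewrite -[lshift _ _]/(unsplit (inl _)) unsplitK.
  by rewrite -[rshift _ _]/(unsplit (inr _)) unsplitK.
pose l := \sum_i wl i - \sum_i wr i.
have sl : 0 <= \sum_i wl i by apply: sumr_ge0 => i _; exact: w0.
have sr : 0 <= \sum_i wr i by apply: sumr_ge0 => i _; exact: w0.
have slr : \sum_i wl i + \sum_i wr i = 1.
  by rewrite -w1 big_split_ord.
exists (\sum_i (wl i + wr i) *: v i).
  exists (fun i => wl i + wr i); split=> //.
  - by move=> i; apply: addr_ge0; exact: w0.
  - by rewrite big_split.
exists (l *: f).
  exists (l *: e); last by rewrite /f !scalerA mulrC.
  by exists l => //=; rewrite /l; lra.
rewrite /l scalerBl !scaler_suml -sumrB -!big_split /=.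
by apply: eq_bigr => i _; apply/rowP => j; rewrite !mxE; ring.
Qed.

Section SumVoronoi.
Variables (R : realType) (d : nat) (cP : set 'rV[R]_d) (A : 'M[R]_d).
Variables (a : 'rV[R]_d -> R) (e : 'rV[R]_d) (b : R).
Implicit Types (p q x y : 'rV[R]_d).
Hypotheses (cPN : symmetric_set cP) (AT : A^T = A) (Au : A \in unitmx).
Hypotheses (aE : forall p, a p = dotp p (p *m A)) (a0 : forall p, 0 <= a p).
Hypothesis Pd : affine_dim (PP cP a) d.
Hypothesis Llat : full_lattice (lattice cP a).
Hypothesis cPL : cP `<=` lattice cP a.
Hypothesis eD : dual (facet_normals cP a) e.
Hypotheses (Hin : sum_within cP a e) (Hout : sum_covers cP a e) (b0 : 0 <= b).

Local Notation g := (fun p => a p + rank1_form b e p).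

Lemma sum_form_quad : exists B : 'M[R]_d,
  [/\ B^T = B, (forall p, g p = dotp p (p *m B)) & forall p, 0 <= g p].
Proof.
exists (A + b *: (e^T *m e)); split.
- by rewrite linearD linearZ /= AT trmx_mul trmxK.
- move=> p; rewrite mulmxDr dotpDr aE; congr (_ + _).
  rewrite -scalemxAr dotpZr mulmxA /rank1_form.
  have -> : p *m e^T *m e = dotp p e *: e.
    by rewrite -mul_scalar_mx [p *m e^T]mx11_scalar -dotpE.
  by rewrite dotpZr expr2.
- by move=> p; rewrite addr_ge0 // rank1_form_ge0.
Qed.

Lemma sum_affine_dim : affine_dim (PP cP g) d.
Proof.
have [x0 [M [Mfree P0 PM Pspan]]] := Pd.
have sub x : PP cP a x -> PP cP g x.
  by move=> Px q cPq; rewrite (le_trans (Px q cPq)) // lerDl rank1_form_ge0.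
exists x0, M; split=> //; [exact: sub | by move=> i; apply: sub |].
move=> x _; apply: submx_full.
by rewrite row_full_unit -row_free_unit.
Qed.

(** Some constraint [q] must be tight inside the facet; it is then parallel to
    [p], and homogeneity of the form fixes its length. *)
Lemma sum_facet_normals_sub : facet_normals cP g `<=` cP.
Proof.
move=> p Fp; have [p0 pv _] := Fp.
have [y [Py py yP]] := facet_relative_interior Fp.
have [B [BT gE g0]] := sum_form_quad.
have pp0 := dotpp_gt0 p0.
have gp0 : 0 < g p.
  exact: symmetric_support_gt0 sum_affine_dim cPN (quad_formN gE) p0 pv.
have [q [cPq q0 qy]] : exists q, [/\ cP q, q != 0 & dotp q y = g q].
  apply: contrapT => none.
  pose C := cP `&` [set q | q != 0].
  have slack q : C q -> dotp q y < g q.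
    move=> [cPq q0]; rewrite lt_neqAle Py // andbT.
    by apply/eqP => qy; apply: none; exists q.
  have CL : C `<=` lattice cP a by move=> q [/cPL].
  have [|h h0 hP] := slack_perturbation AT Au aE a0 Llat p CL _ slack.
    by move=> q _; rewrite lerDl rank1_form_ge0.
  have : PP cP g (y + h *: p).
    move=> q cPq; have [->|q0] := eqVneq q 0; first by rewrite dotp0l.
    have := hP q (conj cPq q0); rewrite dotpDr dotpZr.
    have := ler_wpM2l (ltW h0) (ler_norm (dotp q p)); lra.
  move/pv; rewrite dotpDr dotpZr py.
  by have := mulr_gt0 h0 pp0; lra.
have qx x : dotp p x = 0 -> dotp q x = 0.
  suff le0 z : dotp p z = 0 -> dotp q z <= 0.
    move=> px; apply/eqP; rewrite eq_le le0 //= -oppr_le0 -dotpNr.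
    by apply: le0; rewrite dotpNr px oppr0.
  move=> pz; have [h h0 /(_ q cPq)] := yP z pz.
  by rewrite dotpDr qy dotpZr gerDl pmulr_rle0.
pose t := dotp q p / dotp p p.
have qE : q = t *: p.
  apply/eqP; rewrite -subr_eq0; apply/eqP; set r := q - _.
  have pr : dotp p r = 0.
    by rewrite /r /t !dotpr (dotpC p q) mulfVK ?subrr ?gt_eqF.
  apply: dotpp_eq0; rewrite {1}/r !dotpl (qx _ pr) pr.
  by rewrite mulr0 subrr.
have t0 : t != 0 by apply: contraNneq q0 => t0; rewrite qE t0 scale0r.
have : t * g p = t * (t * g p).
  transitivity (g q); first by rewrite -qy qE dotpZl py.
  by rewrite !gE qE -scalemxAl dotpZl dotpZr.
move=> /(mulfI t0); rewrite -{1}[g p]mul1r => /(mulIf (lt0r_neq0 gp0)) t1.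
by move: cPq; rewrite qE -t1 scale1r.
Qed.

(** A facet of the summand with normal [p] reappears in the sum, translated by
    [b * <p, e>] along [e]: the height gained, [b * <p, e> ^ 2], is the increase
    of the form. *)
Lemma sum_facet_normals_super : facet_normals cP a `<=` facet_normals cP g.
Proof.
move=> p Fp; have [p0 pv [x0 [M [Mfree [P0 p_x0] PM _]]]] := Fp.
have Mp i : dotp p (row i M) = 0.
  by have [_] := PM i; rewrite /= dotpDr p_x0; lra.
set s := dotp p e.
have s3 : [\/ s = 0, s = 1 | s = -1] by rewrite /s dotpC; exact: eD.
have shift x : PP cP a x -> PP cP g (x + (b * s) *: e).
  move=> Px; apply: Hin => //; apply/sum_segmentP => //.
  exists (b * s); last by rewrite addrK.
  by have := b0; case: s3 => ->; lra.
apply: (@facet_normalsI _ _ _ _ _ (x0 + (b * s) *: e) M) => //.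
- move=> x /(Hout b0) /(sum_segmentP _ _ _ _ b0) [l lb /pv].
  rewrite !dotpr -/s /rank1_form -/s.
  suff : l * s <= b * s ^+ 2 by lra.
  by case: s3 => ->; lra.
- by rewrite dotpDr dotpZr p_x0 /rank1_form -/s; ring.
- exact: shift.
- by move=> i; rewrite addrAC; apply: shift; have [] := PM i.
Qed.

Lemma sum_lattice : lattice cP g = lattice cP a.
Proof.
have [L0 LD LN] := full_lattice_closed Llat.
apply/seteqP; split.
  apply: integral_span_min => //.
  exact: subset_trans sum_facet_normals_sub cPL.
move=> _ [n [c [v [Fv ->]]]]; exists n, c, v; split=> // i.
exact: sum_facet_normals_super.
Qed.

Lemma sum_segmentE : minkowski (PP cP a) (dilate b (segment e)) = PP cP g.
Proof. by apply/seteqP; split=> z; [exact: Hin | exact: Hout]. Qed.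

Lemma sum_voronoi_form : is_polytope (PP cP a) -> voronoi_form cP g.
Proof.
move=> Ppoly; split.
  split; last exact: sum_affine_dim.
  by rewrite -sum_segmentE; exact: polytope_add_segment.
split; [exact: sum_form_quad | exact: sum_facet_normals_sub |].
by rewrite sum_lattice.
Qed.

End SumVoronoi.

(** * The equivalence *)

Section Equivalence.
Variables (R : realType) (d : nat) (cP : set 'rV[R]_d).
Variable a : 'rV[R]_d -> R.
Implicit Types e : 'rV[R]_d.
Hypotheses (cPN : symmetric_set cP) (Pa : voronoi_form cP a).
Hypothesis CcP : contact_vectors cP a `<=` cP.
Hypothesis FC : facet_normals cP a `<=` contact_vectors cP a.

Lemma segment_sum_dual e : segment_sum_voronoi cP a e ->
  dual (facet_normals cP a) e.
Proof.
case: Pa => -[_ Pd] [[A [AT aE a0]] FcP _] He.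
apply: (sum_dual cPN AT aE a0 FcP Pd) => b b0 z;
by have [_ _ ->] := He b b0.
Qed.

Lemma dual_segment_sum e : cP `<=` lattice cP a ->
  dual (facet_normals cP a) e -> segment_sum_voronoi cP a e.
Proof.
move=> cPL eD; case: Pa => -[Ppoly Pd] [[A [AT aE a0]] FcP Llat].
have Au := form_unitmx cPN AT aE a0 Pd Llat FC CcP.
have Hin : sum_within cP a e by exact: sum_within_lattice.
have Hout : sum_covers cP a e by exact: (sum_covers_lattice cPN AT aE).
move=> b b0 /=; split.
- exists (fun p => a p + rank1_form b e p); last exact: sum_segmentE.
  exact: (sum_voronoi_form cPN AT Au aE).
- apply/seteqP; split=> z.
    case=> x Px [y Sy <-]; exists x => //; exists y => //.
    move: Sy => [_ [l /= l1 <-] <-] q cPq.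
    rewrite !dotpZr /rank1_form ler_wpM2l //.
    apply: le_trans (sum_within_norm a0 Hin cPq).
    by have [e0|e0] := ger0P (dotp q e); nra.
  case=> x Px [y Py <-]; rewrite sum_segmentE // => q cPq.
  by rewrite dotpDr; apply: lerD; [exact: Px | exact: Py].
- exact: sum_segmentE.
Qed.

Lemma facet_normals_orthogonal e :
  (forall p, facet_normals cP a p -> dotp e p = 0) -> e = 0.
Proof.
case: Pa => _ [_ _ [B Bu LE]] e0.
have eL : lattice cP a `<=` [set u | dotp u e = 0].
  apply: integral_span_min => /=.
  - by move=> p /e0; rewrite dotpC.
  - by rewrite dotp0l.
  - by move=> u v; rewrite dotpDl => -> ->; rewrite addr0.
  - by move=> u; rewrite dotpNl => ->; rewrite oppr0.
apply: trmx_inj; rewrite trmx0 -(mulKmx Bu e^T).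
rewrite (_ : B *m e^T = 0) ?mulmx0 //; apply/matrixP => i j.
have : lattice cP a (row i B).
  rewrite LE; exists (delta_mx 0 i) => //.
  by rewrite rowE map_delta_mx.
move/eL => /= Be; rewrite [RHS]mxE -[RHS]Be dotpE -row_mul [RHS]mxE.
by rewrite (ord1 j).
Qed.

(** For [e = 0] every multiple is in the dual set, so that the first assertion
    has to hold, for an arbitrary [cP]. *)
Lemma segment_sum_voronoi0 : segment_sum_voronoi cP a 0.
Proof.
case: (Pa) => -[_ Pd] [_ FcP _] b b0 /=.
have sE : PP cP (fun p => a p + rank1_form b 0 p) = PP cP a.
  congr PP; apply/funext => p; by rewrite /rank1_form dotp0r expr0n mulr0 addr0.
have s0 : dilate b (segment 0) = [set 0 : 'rV[R]_d].
  apply/seteqP; split=> x.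
    by case=> _ [l _ <-] <-; rewrite !scaler0.
  by move=> ->; exists 0; rewrite ?scaler0 //; exists 0; rewrite ?scaler0 //=; lra.
have r0 : PP cP (rank1_form b 0) = [set 0 : 'rV[R]_d].
  apply/seteqP; split=> [x Px|x -> q _]; last first.
    by rewrite /rank1_form dotp0r expr0n mulr0.
  apply: facet_normals_orthogonal => p /FcP cPp.
  have := Px p cPp; have := Px _ (cPN cPp).
  rewrite /rank1_form !dotp0r expr0n mulr0 dotpNl (dotpC x).
  by move=> h1 h2; apply/eqP; rewrite eq_le h2; lra.
have P0 : minkowski (PP cP a) [set 0] = PP cP a.
  apply/seteqP; split=> [_ [x Px [_ -> <-]]|x Px]; first by rewrite addr0.
  by exists x => //; exists 0; rewrite ?addr0.
by rewrite s0 r0 P0 sE; split=> //; exists a.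
Qed.

End Equivalence.

Theorem theorem1 (R : realType) (d : nat) (cP : set 'rV[R]_d)
    (a : 'rV[R]_d -> R) (e : 'rV[R]_d)
    (cP_sym : symmetric_set cP)
    (a_voronoi : voronoi_form cP a)
    (a_irr : irreducible (PP cP a))
    (contact_cP : contact_vectors cP a `<=` cP)
    (facet_contact : facet_normals cP a `<=` contact_vectors cP a) :
  exists2 l : R, 0 < l
    & [/\ segment_sum_voronoi cP a (l *: e)
            <-> dual (facet_normals cP a) (l *: e),
          (* the length l is one that works whenever some length does *)
          forall m : R, 0 < m ->
            segment_sum_voronoi cP a (m *: e) ->
            segment_sum_voronoi cP a (l *: e)
        & cP `<=` lattice cP a ->
          forall m : R, 0 < m ->
            dual (facet_normals cP a) (m *: e) ->
            dual (facet_normals cP a) (l *: e)].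
Proof.
have S2D e' := @segment_sum_dual R d cP a cP_sym a_voronoi e'.
have [[l l0 Sl]|noS] :=
  pselect (exists2 l : R, 0 < l & segment_sum_voronoi cP a (l *: e)).
  exists l => //; split=> //; first by split=> // _; exact: S2D.
  by move=> _ _ _ _; exact: S2D.
have D2S := dual_segment_sum cP_sym a_voronoi contact_cP facet_contact.
have [l l0 nD] : exists2 l : R, 0 < l & ~ dual (facet_normals cP a) (l *: e).
  apply: contrapT => allD.
  have D l : 0 < l -> dual (facet_normals cP a) (l *: e).
    by move=> l0; apply: contrapT => nD; apply: allD; exists l.
  (* If both [e] and [2 *: e] are dual, then [e] is orthogonal to all facet
     normals. *)
  apply: noS; exists 1 => //; rewrite scale1r.
  rewrite (facet_normals_orthogonal a_voronoi (e := e)).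
    exact: segment_sum_voronoi0.
  move=> p Fp.
  have := D 2 (ltr0Sn _ 1) p Fp; have := D 1 ltr01 p Fp; rewrite !dotpl.
  by case=> h1; case=> h2; lra.
exists l => //; split.
- by split=> [/S2D//|/nD].
- by move=> m m0 Sm; case: noS; exists m.
- by move=> cPL m m0 Dm; case: noS; exists m => //; exact: D2S.
Qed.
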